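(* Let $c\in\{+,-\}^{n-1}$, and let $T_c$ be the corresponding path triangulation of the convex $(n+3)$-gon. The normal fan of the Santos associahedron $\mathrm{Ass}^{\mathrm{II}}_n(T_c)$ (constructed with $V=\{x\in\mathbb R^{n+1}:\sum x_i=0\}$, with $\alpha_1,\dots,\alpha_n$ the simple roots of type $A_n$, and with the diagonals of $T_c$ numbered $\delta_1,\dots,\delta_n$ in the order they appear in the dual path) coincides with the $c$-cluster fan of type $A_n$.
   Context: **Santos associahedron.** A diagonal means an internal diagonal; two diagonals cross if they meet in a point interior to both; a triangulation of a convex $(n+3)$-gon is identified with its set of $n$ pairwise non-crossing diagonals. Given a triangulation $T_0=\{\delta_1,\dots,\delta_n\}$ and a basis $\alpha_1,\dots,\alpha_n$ of $V$, associate to each diagonal $pq$ the vector $v_{pq}=-\alpha_i$ if $pq=\delta_i$, and $v_{pq}=\sum_{i:\ pq\text{ crosses }\delta_i}\alpha_i$ if $pq\notin T_0$. The cones generated by $\{v_\delta:\delta\in T\}$, for all triangulations $T$ of the $(n+3)$-gon, are the maximal cones of a complete simplicial fan $\mathcal F_{T_0}$ in $V$, which is the normal fan of a polytope; $\mathrm{Ass}^{\mathrm{II}}_n(T_0)$ denotes any polytope with this normal fan. **Path triangulations.** A path triangulation is one whose dual tree is a path. Given $c\in\{+,-\}^{n-1}$, $T_c$ is the path triangulation (unique up to rotation of the polygon) with diagonals $\delta_1,\dots,\delta_n$ in the order of the dual path, such that at the $i$-th of the $n-1$ triangles that are not end points of the dual path (the triangle with sides $\delta_i,\delta_{i+1}$)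 the dual path, traversed from $\delta_1$ to $\delta_n$, turns right if the $i$-th sign of $c$ is $+$ and left if it is $-$. **Coxeter element.** In type $A_n$, with simple reflections $s_1,\dots,s_n$ and simple roots $\alpha_i=e_i-e_{i+1}$, the sequence $c$ represents the Coxeter element given by the product of $s_1,\dots,s_n$ in any order such that $s_{i+1}$ comes after $s_i$ if the $i$-th sign of $c$ is $+$, and before $s_i$ if it is $-$. **$c$-cluster fan (Reading).** Let $\Phi_{\ge-1}$ be the set of almost positive roots of type $A_n$ (positive roots $e_i-e_j$, $i<j$, together with the negatives of the simple roots). For a simple reflection $s=s_i$ define the involution $\tau_s$ of $\Phi_{\ge-1}$ by $\tau_s(\beta)=\beta$ if $\beta=-\alpha_j$ with $j\ne i$, and $\tau_s(\beta)=s(\beta)$ otherwise. The $c$-compatibility relations $\|_c$ (one for each Coxeter element $c$) on pairs of distinct almost positive roots are the unique symmetric relations such that: (i) $-\alpha_i\,\|_c\,\beta$ if and only if the coefficient of $\alpha_i$ in the expansion of $\beta$ in simple roots is zero (for $\beta\neq-\alpha_i$); (ii) if $s$ is initial in $c$ (i.e. $c$ has a reduced word starting with $s$), then $\beta_1\,\|_c\,\beta_2$ if and only if $\tau_s(\beta_1)\,\|_{scs}\,\tau_s(\beta_2)$. The $c$-cluster complex is the simplicial complex of sets of pairwise $c$-compatible almost positive roots, its maximal simplices are the $c$-clusters, and the $c$-cluster fan is the fan whose maximal cones are the cones generated by the $c$-clusters. *)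

(* Defs.v *)
From HB Require Import structures.
From mathcomp Require Import all_boot all_order all_algebra all_fingroup.
From mathcomp Require Import boolp classical_sets reals.
Set Implicit Arguments.
Unset Strict Implicit.
Unset Printing Implicit Defensive.
Import Order.TTheory GRing.Theory Num.Theory.
Local Open Scope classical_set_scope.
Local Open Scope ring_scope.

(** * Cones, fans and polytopes in R^m *)

Section Fans.
Context {R : realType} {m : nat}.
Local Notation E := 'rV[R]_m.

Definition dot (u v : E) : R := \sum_i u 0 i * v 0 i.

Definition cone (S : set E) : set E :=
  [set x | exists (k : nat) (u : 'I_k -> E) (a : 'I_k -> R),
     (forall j, S (u j) /\ 0 <= a j) /\ x = \sum_j a j *: u j].

Definition conv_hull (S : set E) : set E :=
  [set x | exists (k : nat) (u : 'I_k -> E) (a : 'I_k -> R),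
     [/\ forall j, S (u j) /\ 0 <= a j, \sum_j a j = 1
       & x = \sum_j a j *: u j]].

Definition cone_face (C F : set E) : Prop :=
  exists l : E, (forall x, C x -> 0 <= dot l x) /\
                F = C `&` [set x | dot l x = 0].

(* A fan is a set of cones closed under taking faces; this is the one whose
   maximal cones are the members of M. *)
Definition fan_of_maximal_cones (M : set (set E)) : set (set E) :=
  [set F | exists2 C, M C & cone_face C F].

End Fans.

Definition V (R : realType) (n : nat) : set 'rV[R]_n.+1 :=
  [set x | \sum_i x 0 i = 0].

Section Polytopes.
Context {R : realType} {n : nat}.
Local Notation E := 'rV[R]_n.+1.

(* V is identified with its dual through the scalar product, so that polytopes
   and their normal fans both live in V. *)
Definition is_polytope (P : set E) : Prop :=
  exists s : seq E, [/\ s != [::], forall x, x \in s -> V x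
                      & P = conv_hull [set x | x \in s]].

Definition face (P : set E) (u : E) : set E :=
  [set x | P x /\ forall y, P y -> dot u y <= dot u x].

Definition normal_cone (P F : set E) : set E :=
  [set v | V v /\ F `<=` face P v].

Definition normal_fan (P : set E) : set (set E) :=
  [set C | exists2 u, V u & C = normal_cone P (face P u)].

End Polytopes.

(** * Roots of type A_n *)

(* With 0-based indices, alpha_i = e_i - e_(i+1) for i < n. *)
Definition ord_low {n} (i : 'I_n) : 'I_n.+1 := widen_ord (leqnSn n) i.
Definition ord_high {n} (i : 'I_n) : 'I_n.+1 := lift ord0 i.

Definition simple_root (R : realType) {n} (i : 'I_n) : 'rV[R]_n.+1 :=
  delta_mx 0 (ord_low i) - delta_mx 0 (ord_high i).

Definition simple_roots (R : realType) (n : nat) : n.-tuple 'rV[R]_n.+1 :=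
  [tuple simple_root R i | i < n].

Definition positive_root {R : realType} {n} (b : 'rV[R]_n.+1) : Prop :=
  exists i j : 'I_n.+1, (i < j)%N /\ b = delta_mx 0 i - delta_mx 0 j.

Definition almost_positive_root {R : realType} {n} : set 'rV[R]_n.+1 :=
  [set b | positive_root b \/ exists i : 'I_n, b = - simple_root R i].

(** * Convex polygons and Santos' fan *)

Section Polygon.
Context {R : realType} {n : nat}.
Local Notation point := (R * R)%type.
Local Notation vertex := 'I_n.+3.

(* Positive iff (a, b, c) is a counterclockwise triangle. *)
Definition orient (a b c : point) : R :=
  (b.1 - a.1) * (c.2 - a.2) - (b.2 - a.2) * (c.1 - a.1).

(* p lists the vertices of a convex (n+3)-gon in counterclockwise order. *)
Definition convex_polygon (p : vertex -> point) : Prop :=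
  forall i j k : vertex, (i < j)%N -> (j < k)%N -> 0 < orient (p i) (p j) (p k).

Variable p : vertex -> point.

Definition is_side (d : {set vertex}) : bool :=
  [exists a, d == [set a; ordS a]%SET].

Definition is_diagonal (d : {set vertex}) : bool :=
  (#|d| == 2)%N && ~~ is_side d.

Definition segment_interior (d : {set vertex}) : set point :=
  [set x | exists (a b : vertex) (t : R),
     [/\ a != b, d = [set a; b]%SET, 0 < t < 1
       & x = ((1 - t) * (p a).1 + t * (p b).1, (1 - t) * (p a).2 + t * (p b).2)]].

Definition crosses (d e : {set vertex}) : Prop :=
  d <> e /\ exists x, segment_interior d x /\ segment_interior e x.

Definition is_triangulation (T : {set {set vertex}}) : Prop :=
  [/\ forall d, d \in T -> is_diagonal d, #|T| = n
    & forall d e, d \in T -> e \in T -> ~ crosses d e].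

(** ** Path triangulations *)

Definition is_triangle (T : {set {set vertex}}) (t : {set vertex}) : Prop :=
  #|t| = 3%N /\
  forall e : {set vertex}, (e \subset t)%SET -> #|e| = 2%N ->
    is_side e \/ e \in T.

Definition dual_adjacent (T : {set {set vertex}}) (t u : {set vertex}) : Prop :=
  t != u /\ (t :&: u)%SET \in T.

(* The triangles of T are t_0, ..., t_n, the dual graph is the path
   t_0 - t_1 - ... - t_n, and delta_i is dual to its edge t_i - t_(i+1). *)
Definition is_dual_path (T : {set {set vertex}}) (delta : 'I_n -> {set vertex})
    (t : 'I_n.+1 -> {set vertex}) : Prop :=
  [/\ injective t,
      forall u, is_triangle T u <-> exists i, u = t i,
      forall i j, dual_adjacent T (t i) (t j) <->
                  (val j = (val i).+1 \/ val i = (val j).+1)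
    & forall i : 'I_n, delta i = (t (ord_low i) :&: t (ord_high i))%SET].

(* A path that enters the triangle aqr through the side aq and leaves it
   through qr turns right iff it has q on its right, that is, iff a, q, r are
   in counterclockwise order. *)
Definition turns_right (d e : {set vertex}) : Prop :=
  exists a q r : vertex, [/\ d = [set a; q]%SET, e = [set q; r]%SET
                           & 0 < orient (p a) (p q) (p r)].

Definition turns_left (d e : {set vertex}) : Prop :=
  exists a q r : vertex, [/\ d = [set a; q]%SET, e = [set q; r]%SET
                           & orient (p a) (p q) (p r) < 0].

(* Sign sequences are tuples of booleans, with true for + and false for -. *)
Definition is_path_triangulation (c : n.-1.-tuple bool)
    (delta : 'I_n -> {set vertex}) : Prop :=
  let T := [set delta i | i : 'I_n]%SET in
  [/\ is_triangulation T,
      exists t, is_dual_path T delta t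
    & forall i j : 'I_n, val j = (val i).+1 ->
        if nth false c i then turns_right (delta i) (delta j)
        else turns_left (delta i) (delta j)].

(** ** Santos' fan of the triangulation {delta_1, ..., delta_n} *)

Variable delta : 'I_n -> {set vertex}.

Definition diagonal_vector (d : {set vertex}) : 'rV[R]_n.+1 :=
  if [pick i | d == delta i] is Some i then - simple_root R i
  else \sum_(i < n | `[< crosses d (delta i) >]) simple_root R i.

Definition santos_maximal_cone (C : set 'rV[R]_n.+1) : Prop :=
  exists T : {set {set vertex}}, is_triangulation T /\
    C = cone [set v | exists2 d, d \in T & v = diagonal_vector d].

Definition santos_fan : set (set 'rV[R]_n.+1) :=
  fan_of_maximal_cones santos_maximal_cone.

Definition is_santos_associahedron (P : set 'rV[R]_n.+1) : Prop :=
  is_polytope P /\ normal_fan P = santos_fan.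

End Polygon.

(** * Coxeter elements of type A_n *)

Section Coxeter.
Context {n : nat}.

(* MathComp composes permutations from left to right. Reversing the convention
   amounts to the anti-automorphism fixing the simple reflections, hence does
   not affect the notions below, which are phrased in terms of words. *)
Definition simple_reflection (i : 'I_n) : 'S_n.+1 :=
  tperm (ord_low i) (ord_high i).

Definition word_product (w : seq 'I_n) : 'S_n.+1 :=
  (\prod_(i <- w) simple_reflection i)%g.

Definition reduced_word (w : seq 'I_n) : Prop :=
  forall w', word_product w' = word_product w -> (size w <= size w')%N.

Definition is_coxeter_element (g : 'S_n.+1) : Prop :=
  exists w : seq 'I_n, perm_eq w (enum 'I_n) /\ g = word_product w.

Definition represents (c : n.-1.-tuple bool) (g : 'S_n.+1) : Prop :=
  exists w : seq 'I_n,
    [/\ perm_eq w (enum 'I_n),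
        forall i j : 'I_n, val j = (val i).+1 ->
          if nth false c i then (index i w < index j w)%N
          else (index j w < index i w)%N
      & g = word_product w].

Definition is_initial (i : 'I_n) (g : 'S_n.+1) : Prop :=
  exists w : seq 'I_n, reduced_word (i :: w) /\ g = word_product (i :: w).

End Coxeter.

(** * The c-cluster fan *)

Section Clusters.
Context {R : realType} {n : nat}.
Local Notation root := 'rV[R]_n.+1.

(* Simple reflections act on R^(n+1) by permuting the coordinates. *)
Definition tau (i : 'I_n) (b : root) : root :=
  if [exists j : 'I_n, (j != i) && (b == - simple_root R j)] then b
  else col_perm (simple_reflection i) b.

Definition is_compatibility_family (Q : 'S_n.+1 -> root -> root -> Prop) : Prop :=
  forall g, is_coxeter_element g ->
  [/\ forall b1 b2, almost_positive_root b1 -> almost_positive_root b2 ->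
        b1 <> b2 -> Q g b1 b2 -> Q g b2 b1,
      forall (i : 'I_n) b, almost_positive_root b -> b <> - simple_root R i ->
        (Q g (- simple_root R i) b <-> coord (simple_roots R n) i b = 0)
    & forall i : 'I_n, is_initial i g ->
        forall b1 b2, almost_positive_root b1 -> almost_positive_root b2 ->
        b1 <> b2 ->
        (Q g b1 b2 <->
         Q (simple_reflection i * g * simple_reflection i)%g
           (tau i b1) (tau i b2))].

(* There is a unique compatibility family, up to its irrelevant values outside
   Coxeter elements and pairs of distinct almost positive roots; this is its
   value at the Coxeter element g. *)
Definition c_compatible (g : 'S_n.+1) (b1 b2 : root) : Prop :=
  exists Q, is_compatibility_family Q /\ Q g b1 b2.

Definition c_cluster_complex (g : 'S_n.+1) : set (set root) :=
  [set S | S `<=` almost_positive_root /\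
           forall b1 b2, S b1 -> S b2 -> b1 <> b2 -> c_compatible g b1 b2].

Definition is_c_cluster (g : 'S_n.+1) (S : set root) : Prop :=
  c_cluster_complex g S /\
  forall S', c_cluster_complex g S' -> S `<=` S' -> S' = S.

Definition c_cluster_fan (g : 'S_n.+1) : set (set root) :=
  fan_of_maximal_cones [set C | exists2 S, is_c_cluster g S & C = cone S].

End Clusters.

(* Main.v *)
Require Import Defs.
From mathcomp Require Import all_boot all_order all_algebra all_fingroup.
From mathcomp Require Import boolp classical_sets reals.
From mathcomp Require Import zify ring lra.

(** Number the triangles t_0, ..., t_n of T_c along the dual path, write O_k for
    the vertex of t_k off delta_k and I_k for the vertex of t_k off delta_(k-1).
    Then v sends the chord O_a I_b to e_a - e_b (indices from 0, a < b), so v is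
    a bijection from diagonals to almost positive roots; whether the chords of
    e_a - e_b and e_k - e_l cross depends only on the relative order of a, b, k,
    l and on the signs of c at the inner ones.  The resulting combinatorial
    relation satisfies Reading's axioms: it changes in the right way when c is
    conjugated by an initial letter s_i, which flips the signs at i and i+1.
    Conversely, applying all the letters of c in turn moves e_a - e_b to
    e_(c a) - e_(c b) until a negative simple root is met, which must happen as
    powers of c take b to 0; so the axioms determine the relation.
    Finally, maximal sets of pairwise noncrossing diagonals are the ones with n
    elements, hence clusters correspond to triangulations. *)

Set Implicit Arguments.
Unset Strict Implicit.
Unset Printing Implicit Defensive.
Import Order.TTheory GRing.Theory Num.Theory.

(** * Combinatorial compatibility of almost positive roots *)

(** [c_compatible] refers to all families satisfying the axioms, so a formula for it needs both one
    family that obeys the formula and an argument valid for every family. For the latter, axiom (ii)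
    only licenses initial letters; but conjugating by the first letter of a word moves that letter
    to the end, so every letter becomes available in turn, and after a full turn the original word
    is back. This is why words, rather than group elements, carry the induction. Two facts about
    polygons are obtained by counting: that the diagonals found from the dual path are all the
    diagonals, and that maximality agrees with having n elements. The second is forced by the
    definitions, since triangulations are defined by cardinality and clusters by maximality. *)

(* Vertices of the polygon are numbered counterclockwise, so this says that
   x, y, z are in counterclockwise order. *)
Definition cyclic (x y z : nat) : bool :=
  [|| x < y < z, y < z < x | z < x < y].

(** The four ends alternate around the polygon, in one of the two possible orders. As [cyclic] is
    strict, chords with a common end do not cross. *)
Definition chords_cross (a b c d : nat) : bool :=
  cyclic a c b && cyclic b d a || cyclic a d b && cyclic b c a.

(* The pair (a, b) stands for the root e_a - e_b, so that (b + 1, b) is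
   -alpha_b.  For two positive roots the clauses say when their chords do not
   cross; only values of [eps] at indices strictly between 0 and n matter. *)
Definition roots_compatible (eps : nat -> bool) (a b k l : nat) : bool :=
  if b < a then (l < k) || ~~ (k <= b < l)
  else if l < k then ~~ (a <= l < b)
  else [&& b != k, l != a,
     (a < k) && (l < b) ==> (eps k == eps l),
     (k < a) && (b < l) ==> (eps a == eps b),
     (a < k < b) && (b < l) ==> (eps k != eps b) &
     (k < a < l) && (l < b) ==> (eps a != eps l)].

Definition almost_positive (a b : nat) : bool := (a < b) || (a == b.+1).

Definition swap_succ (i a : nat) : nat :=
  if a == i then i.+1 else if a == i.+1 then i else a.

(** For almost positive pairs, [b < a] means [a = b.+1], so the first branch consists of the fixed
    roots -alpha_b with b different from i. *)
Definition tau_index (i a b : nat) : nat * nat :=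
  if (b < a) && (b != i) then (a, b) else (swap_succ i a, swap_succ i b).

Lemma roots_compatible_ext n eps eps' a b k l :
  (forall j, 0 < j < n -> eps j = eps' j) ->
  a <= n -> b <= n -> k <= n -> l <= n ->
  roots_compatible eps a b k l = roots_compatible eps' a b k l.
Proof.
move=> E ha hb hk hl; rewrite /roots_compatible.
case: ifP => // hab; case: ifP => // hkl.
congr [&& _, _, _, _, _ & _].
- by case: (boolP (_ && _)) => // h; rewrite !E; lia.
- by case: (boolP (_ && _)) => // h; rewrite !E; lia.
- by case: (boolP (_ && _)) => // h; rewrite !E; lia.
- by case: (boolP (_ && _)) => // h; rewrite !E; lia.
Qed.

Lemma roots_compatible_sym eps a b k l :
  roots_compatible eps a b k l = roots_compatible eps k l a b.
Proof.
rewrite /roots_compatible; case: (ltnP b a) => h1; case: (ltnP l k) => h2 //=.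
rewrite andbCA; congr [&& _, _ & _]; rewrite andbCA; congr [&& _, _ & _].
exact: andbC.
Qed.

Lemma swap_succ_cases i a :
  [\/ a = i /\ swap_succ i a = i.+1, a = i.+1 /\ swap_succ i a = i |
      [/\ a <> i, a <> i.+1 & swap_succ i a = a]].
Proof.
rewrite /swap_succ; case: eqP => [->|h1]; first by constructor 1.
by case: eqP => [->|h2]; [constructor 2|constructor 3].
Qed.

(** The signs are arguments of their own so that they can be generalized, which leaves [lia] a
    problem about four integers and four booleans. *)
Definition pos_compatible (a b k l : nat) (ea eb ek el : bool) : bool :=
  [&& b != k, l != a,
     (a < k) && (l < b) ==> (ek == el),
     (k < a) && (b < l) ==> (ea == eb),
     (a < k < b) && (b < l) ==> (ek != eb) &
     (k < a < l) && (l < b) ==> (ea != el)].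

Lemma roots_compatible_pos eps a b k l : a < b -> k < l ->
  roots_compatible eps a b k l =
  pos_compatible a b k l (eps a) (eps b) (eps k) (eps l).
Proof.
by move=> h1 h2; rewrite /roots_compatible (leq_gtF (ltnW h1)) (leq_gtF (ltnW h2)).
Qed.

Lemma roots_compatible_neg eps b k l : k < l ->
  roots_compatible eps b.+1 b k l = ~~ (k <= b < l).
Proof. by move=> h; rewrite /roots_compatible ltnSn (leq_gtF (ltnW h)). Qed.

(** Since the signs at i and i + 1 are opposite, flipping both amounts to exchanging them:
    [eps' (swap_succ i x) = eps x]. Each index thus carries its sign along, and only comparisons
    between i and i + 1 change. *)
Lemma roots_compatible_tau i eps eps' a b k l :
  almost_positive a b -> almost_positive k l -> (a, b) != (k, l) ->
  eps i = false -> eps i.+1 = true ->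
  (forall j, eps' j = if (j == i) || (j == i.+1) then ~~ eps j else eps j) ->
  roots_compatible eps a b k l =
  roots_compatible eps' (tau_index i a b).1 (tau_index i a b).2
                       (tau_index i k l).1 (tau_index i k l).2.
Proof.
move=> vab vkl ne e1 e2 E.
have E1 : eps' i = true by rewrite E eqxx e1.
have E2 : eps' i.+1 = false by rewrite E eqxx orbT e2.
have E3 j : j <> i -> j <> i.+1 -> eps' j = eps j.
  by move=> /eqP/negPf h1 /eqP/negPf h2; rewrite E h1 h2.
have {}ne : a <> k \/ b <> l.
  by case: (a =P k) ne => [->|] h; [right=> bl; rewrite bl eqxx in h|left].
have si : swap_succ i i = i.+1 by rewrite /swap_succ eqxx.
have sSi : swap_succ i i.+1 = i by rewrite /swap_succ eqxx; case: eqP; lia.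
have tneg : tau_index i i.+1 i = (i, i.+1) by rewrite /tau_index ltnSn eqxx si sSi.
have tpos : tau_index i i i.+1 = (i.+1, i).
  by rewrite /tau_index (leq_gtF (leqnSn _)) si sSi.
have tid j : j <> i -> tau_index i j.+1 j = (j.+1, j).
  by rewrite /tau_index ltnSn => /eqP ->.
have tgen x y : x < y -> ~ (x = i /\ y = i.+1) ->
    tau_index i x y = (swap_succ i x, swap_succ i y) /\ swap_succ i x < swap_succ i y.
  rewrite /tau_index => h; rewrite (leq_gtF (ltnW h)) /= => h'; split=> //.
  by rewrite /swap_succ; do 4?case: eqP; lia.
have split x : [\/ [/\ x = i, swap_succ i x = i.+1, eps x = false & eps' (swap_succ i x) = false],
    [/\ x = i.+1, swap_succ i x = i, eps x = true & eps' (swap_succ i x) = true] |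
    [/\ x <> i, x <> i.+1, swap_succ i x = x & eps' (swap_succ i x) = eps x]].
  case: (swap_succ_cases i x) => [[-> ->]|[-> ->]|[h1 h2 ->]];
    [constructor 1|constructor 2|constructor 3]; split => //; exact: E3.
have negpos x y z : y < z ->
    roots_compatible eps x.+1 x y z =
    roots_compatible eps' (tau_index i x.+1 x).1 (tau_index i x.+1 x).2
                       (tau_index i y z).1 (tau_index i y z).2.
  move=> yz; rewrite roots_compatible_neg //; case: (x =P i) => [->|hx].
    rewrite tneg /=; case: (y =P i) => hy; last first.
      have [||-> h] := tgen y z; try lia.
      rewrite roots_compatible_pos //= /pos_compatible.
      rewrite E1 E2; move: (eps' _) (eps' _) => ey ez.
      clear - split yz hy h.
      by case: (split y) => -[A1 A2 A3 A4]; case: (split z) => -[B1 B2 B3 B4]; lia.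
    subst y; case: (z =P i.+1) => [->|hz].
      rewrite tpos /= roots_compatible_sym roots_compatible_neg //; lia.
    have [||-> h] := tgen i z; try lia.
    rewrite roots_compatible_pos //= /pos_compatible si; lia.
  rewrite tid //=; case: (boolP ((y == i) && (z == i.+1))) => [/andP[/eqP -> /eqP ->]|hyz].
    by rewrite tpos /roots_compatible !ltnSn /=; lia.
  have [||-> h] := tgen y z; try lia.
  rewrite roots_compatible_neg //=; move: h; rewrite /swap_succ.
  by do 4?case: eqP; lia.
case/orP: (vab) => [hab|/eqP ?]; case/orP: (vkl) => [hkl|/eqP ?]; try subst a; try subst k.
(* [tau] turns alpha_i into -alpha_i, so here all the clauses must collapse into one: alpha_i does
   not occur in the image of the other root. *)
- have specl y z : y < z -> i <> y \/ i.+1 <> z ->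
    roots_compatible eps i i.+1 y z =
    roots_compatible eps' (tau_index i i i.+1).1 (tau_index i i i.+1).2
                       (tau_index i y z).1 (tau_index i y z).2.
    move=> yz nyz; have [||-> h] := tgen y z; try lia.
    rewrite tpos /= roots_compatible_pos // roots_compatible_neg //.
    rewrite /pos_compatible e1 e2; clear - split yz nyz h.
    by case: (split y) => -[A1 A2 A3 _]; case: (split z) => -[B1 B2 B3 _]; lia.
  case: (boolP ((a == i) && (b == i.+1))) => [/andP[/eqP ? /eqP ?]|hab'].
    by subst a b; apply: specl.
  case: (boolP ((k == i) && (l == i.+1))) => [/andP[/eqP ? /eqP ?]|hkl'].
    rewrite roots_compatible_sym [RHS]roots_compatible_sym.
    by subst k l; apply: specl => //; case: ne; [left|right]; lia.
  have [||-> h] := tgen a b; try lia.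
  have [||-> h'] := tgen k l; try lia.
  rewrite !roots_compatible_pos //=.
  have {}hab' : ~ (a = i /\ b = i.+1) by lia.
  have {}hkl' : ~ (k = i /\ l = i.+1) by lia.
  (* A positive root other than alpha_i has at most one end in {i, i + 1}, which gives five
     configurations for each of the two roots. *)
  have pairs x y : x < y -> ~ (x = i /\ y = i.+1) ->
    let: (sx, sy) := (swap_succ i x, swap_succ i y) in
    let: (ex, ey, fx, fy) := (eps x, eps y, eps' sx, eps' sy) in
    [\/ [/\ x = i, i.+1 < y, sx = i.+1 & sy = y] /\ [/\ ex = false, fx = false & fy = ey],
        [/\ x = i.+1, i.+1 < y, sx = i & sy = y] /\ [/\ ex = true, fx = true & fy = ey],
        [/\ y = i, x < i, sx = x & sy = i.+1] /\ [/\ ey = false, fy = false & fx = ex] |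
        [/\ y = i.+1, x < i, sx = x & sy = i] /\ [/\ ey = true, fy = true & fx = ex]] \/
    [/\ x < y, x < i \/ i.+1 < x, y < i \/ i.+1 < y, sx = x & sy = y] /\ (fx = ex /\ fy = ey).
    clear - split => h h' /=.
    case: (split x) => -[A1 A2 A3 A4]; case: (split y) => -[B1 B2 B3 B4]; try (exfalso; lia).
    - by left; constructor 1; do !split=> //; lia.
    - by left; constructor 2; do !split=> //; lia.
    - by left; constructor 3; do !split=> //; lia.
    - by left; constructor 4; do !split=> //; lia.
    - by right; do !split=> //; lia.
  move: (pairs _ _ hab hab') (pairs _ _ hkl hkl'); clear - ne.
  move: (eps a) (eps b) (eps k) (eps l) (eps' _) (eps' _) (eps' _) (eps' _).
  move: (swap_succ i a) (swap_succ i b) (swap_succ i k) (swap_succ i l).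
  move=> a' b' k' l' ea eb ek el fa fb fk fl; rewrite /pos_compatible.
  by do 2!case=> [[]|] [[? ? ? ?]] => [[? ? ?]|[? ? ?]|[? ? ?]|[? ? ?]|? [? ?]]; subst; lia.
- by rewrite roots_compatible_sym [RHS]roots_compatible_sym; apply: negpos.
- exact: negpos.
- rewrite /roots_compatible !ltnSn /=.
  case: (b =P i) => [?|hb]; first subst b.
    rewrite tneg tid /=; last lia.
    by rewrite ltnSn (leq_gtF (leqnSn _)) /=; lia.
  rewrite tid //; case: (l =P i) => [?|hl]; first subst l.
    by rewrite tneg /= ltnSn (leq_gtF (leqnSn _)) /=; lia.
  by rewrite tid //= !ltnSn.
Qed.

(** * Chords across a path triangulation *)

Definition weakly_left (x y z : nat) : bool := [|| z == x, z == y | cyclic x y z].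
Definition weakly_right (x y z : nat) : bool := [|| z == x, z == y | cyclic x z y].

Lemma chords_crossC a b c d : chords_cross a b c d = chords_cross c d a b.
Proof. rewrite /chords_cross /cyclic; lia. Qed.

Lemma opposite_sides_noncrossing x y a b c d :
  weakly_left x y a -> weakly_left x y b -> weakly_right x y c -> weakly_right x y d ->
  chords_cross a b c d = false.
Proof. rewrite /weakly_left /weakly_right /chords_cross /cyclic; lia. Qed.

Lemma cyclic_rot x y z : cyclic x y z = cyclic y z x.
Proof. by rewrite /cyclic orbC -orbA. Qed.

Lemma chain_chords_cross x p q r s :
  cyclic x p q -> cyclic x q r -> cyclic x r s -> chords_cross p r q s.
Proof. rewrite /chords_cross /cyclic; lia. Qed.

Lemma chords_cross_flipl a b c d : chords_cross a b c d = chords_cross b a c d.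
Proof. by rewrite /chords_cross orbC andbC [X in _ || X]andbC. Qed.

Lemma chords_cross_flipr a b c d : chords_cross a b c d = chords_cross a b d c.
Proof. by rewrite /chords_cross orbC. Qed.

(* [X k] and [Y k] are the ends of delta_k, the past (the triangles t_0, ...,
   t_k) being on the left of the line from [X k] to [Y k]; [O k] is the vertex
   of t_k that does not belong to delta_k and [I k] the one that does not
   belong to delta_(k-1). *)
Section Zigzag.
Variables (n : nat) (eps : nat -> bool) (X Y O I : nat -> nat).
Hypothesis out_left : forall i k, i <= k < n -> cyclic (X k) (Y k) (O i).
Hypothesis in_right : forall k j, k < j <= n -> cyclic (X k) (I j) (Y k).
Hypothesis out_right : forall k i, k < i < n -> weakly_right (X k) (Y k) (O i).
Hypothesis in_left : forall j k, 0 < j <= k -> k < n -> weakly_left (X k) (Y k) (I j).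
Hypothesis stepE : forall k, 0 < k < n ->
  if eps k then [/\ X k = X k.-1, O k = Y k.-1 & I k = Y k]
  else [/\ Y k = Y k.-1, O k = X k.-1 & I k = X k].

(** [O i] is strictly left of delta_k once i <= k, and [I j] strictly right of it as long as k < j;
    outside this range both points are weakly on one side. Hence the simple roots in the vector of
    this chord telescope to e_i - e_j. *)
Lemma cross_delta i j k : i < j <= n -> k < n ->
  chords_cross (O i) (I j) (X k) (Y k) = (i <= k < j).
Proof.
move=> ij kn; case: (ltnP k i) => ki /=.
  have := out_right (k := k) (i := i); have := in_right (k := k) (j := j).
  rewrite /weakly_right /chords_cross /cyclic; lia.
case: (ltnP k j) => kj.
  have := out_left (k := k) (i := i); have := in_right (k := k) (j := j).
  rewrite /chords_cross /cyclic; lia.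
have := out_left (k := k) (i := i); have := in_left (k := k) (j := j).
rewrite /weakly_left /chords_cross /cyclic; lia.
Qed.

(** The same crossing seen from the other chord: the line from [O i] to [I j] has [Y k] on its left
    and [X k] on its right. *)
Lemma delta_sides i j k : i <= k < j -> j <= n ->
  cyclic (O i) (I j) (Y k) /\ cyclic (O i) (X k) (I j).
Proof.
move=> ik jn.
have := out_left (k := k) (i := i); have := in_right (k := k) (j := j).
rewrite /cyclic; lia.
Qed.

(** This is how signs enter: by [stepE] the points [O k] and [I k] are both among the Y's or both
    among the X's, according to [eps k]. *)
Lemma step_sides i j k : i < k < j -> j <= n ->
  if eps k then cyclic (O i) (I j) (O k) /\ cyclic (O i) (I j) (I k)
  else cyclic (O i) (O k) (I j) /\ cyclic (O i) (I k) (I j).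
Proof.
move=> ik jn; have kn : 0 < k < n by lia.
have [||Y1 X1] := @delta_sides i j k; [lia|lia|].
have [||Y2 X2] := @delta_sides i j k.-1; [lia|lia|].
by move: (stepE kn); case: (eps k) => -[E1 E2 E3]; rewrite E2 E3; split; congruence.
Qed.

(** The diagonal delta_j separates the two chords. *)
Lemma cross_disjoint i j k l : i < j -> j < k -> k < l <= n ->
  chords_cross (O i) (I j) (O k) (I l) = false.
Proof.
move=> ij jk kl; apply: (@opposite_sides_noncrossing (X j) (Y j)).
- by rewrite /weakly_left out_left ?orbT //; lia.
- by apply: in_left; lia.
- by apply: out_right; lia.
- by rewrite /weakly_right in_right ?orbT //; lia.
Qed.

(** Seen from the common end of delta_(j-1) and delta_j, the points come in the order I_l, I_j, O_j,
    O_i or in the reverse one, so they alternate. *)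
Lemma cross_adjacent i j l : i < j < l -> l <= n ->
  chords_cross (O i) (I j) (O j) (I l).
Proof.
move=> ijl ln; have jn : 0 < j < n by lia.
have [h1 h2 h3] : [/\ i <= j.-1 < n, j.-1 < j <= n & j < l <= n] by split; lia.
move: (out_left h1) (in_right h2) (in_right h3).
move: (stepE jn); case: (eps j) => -[E1 E2 E3] H1 H2 H3.
  rewrite E2 E3 chords_crossC chords_cross_flipl chords_cross_flipr.
  by apply: (@chain_chords_cross (X j)) => //; rewrite E1 // -E3.
rewrite E2 E3; apply: (@chain_chords_cross (Y j)).
- by rewrite 2!cyclic_rot E1.
- by rewrite cyclic_rot E1 -E3.
- by rewrite cyclic_rot.
Qed.

Lemma cross_nested i j k l : i < k < l -> l < j <= n ->
  chords_cross (O i) (I j) (O k) (I l) = (eps k != eps l).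
Proof.
move=> ikl lj.
have [h1 h2 h3] : [/\ i < k < j, i < l < j & j <= n] by split; lia.
move: (step_sides h1 h3) (step_sides h2 h3).
by case: (eps k); case: (eps l) => -[A1 A2] [B1 B2] /=;
  move: A1 B2; rewrite /chords_cross /cyclic; lia.
Qed.

(** The sides given by [step_sides] for [O k] and [I j] leave the position of [I l] relative to
    [O i] open; delta_j, which ends at [I j] and separates these two points, settles it. *)
Lemma cross_interleaved i j k l : i < k < j -> j < l <= n ->
  chords_cross (O i) (I j) (O k) (I l) = (eps k == eps j).
Proof.
move=> ikj jl.
have [h1 h2] : i < k < j /\ j <= n by lia.
have [h3 h4] : k < j < l /\ l <= n by lia.
have h5 : i <= j < n by lia.
have h6 : j < l <= n by lia.
have h7 : 0 < j < n by lia.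
move: (step_sides h1 h2) (step_sides h3 h4) (out_left h5) (in_right h6) (stepE h7).
by case: (eps k); case: (eps j) => -[A1 _] [_ B2] C1 C2 [D1 D2 D3] /=;
  move: A1 B2 C1 C2; rewrite ?D3 /chords_cross /cyclic; lia.
Qed.

Lemma cross_in_out i j k l : i < j <= n -> k < l <= n ->
  chords_cross (O i) (I j) (O k) (I l) = ~~ roots_compatible eps i j k l.
Proof.
move=> /andP[ij jn] /andP[kl ln]; rewrite roots_compatible_pos // /pos_compatible.
have [jk|jk|jk] := ltngtP j k.
- rewrite cross_disjoint ?jk ?kl //; lia.
- have [li|li|li] := ltngtP l i.
  + rewrite chords_crossC cross_disjoint ?li ?ij //; lia.
  + have [ik|ik|ik] := ltngtP i k; have [jl|jl|jl] := ltngtP j l.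
    * by rewrite cross_interleaved ?ik ?jl //; lia.
    * by rewrite cross_nested ?ik ?jl //; lia.
    * subst l. rewrite /chords_cross /cyclic; lia.
    * by rewrite chords_crossC cross_nested ?ik ?jl //; lia.
    * by rewrite chords_crossC cross_interleaved ?ik ?jl //; lia.
    * subst l. rewrite /chords_cross /cyclic; lia.
    * subst k. rewrite /chords_cross /cyclic; lia.
    * subst k. rewrite /chords_cross /cyclic; lia.
    * subst k. rewrite /chords_cross /cyclic; lia.
  + by subst l; rewrite chords_crossC cross_adjacent ?kl //; lia.
- by subst k; rewrite cross_adjacent ?ij //; lia.
Qed.
End Zigzag.

(** * Coxeter elements *)

Section Coxeter.
Variable n : nat.
Implicit Types (i j : 'I_n) (x : 'I_n.+1) (w : seq 'I_n) (g : 'S_n.+1).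

(* Products of permutations apply their left factor first: the letter k - 1 comes
   before the letter k in a word for [g] iff [g] decreases k. *)
Definition coxeter_sign g (k : nat) : bool := g (inord k) < k.

Lemma simple_reflectionE i x : simple_reflection i x = swap_succ i x :> nat.
Proof.
rewrite /simple_reflection /swap_succ; case: tpermP => [->|->|h1 h2] /=.
- by rewrite eqxx.
- by rewrite /bump leq0n add1n gtn_eqF // eqxx.
- case: eqP => [h|_]; first by case: h1; apply: ord_inj.
  case: eqP => [h|//]; case: h2; apply: ord_inj.
  by rewrite /= /bump leq0n add1n; exact: h.
Qed.

Lemma word_product_cons i w : word_product (i :: w) = (simple_reflection i * word_product w)%g.
Proof. by rewrite /word_product big_cons. Qed.

Lemma word_product_cat w1 w2 : word_product (w1 ++ w2) = (word_product w1 * word_product w2)%g.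
Proof. by rewrite /word_product big_cat. Qed.

Lemma simple_reflectionK i : (simple_reflection i * simple_reflection i = 1)%g.
Proof. exact: tperm2. Qed.

Lemma word_product_fix w x :
  (forall i, i \in w -> i <> x :> nat /\ i.+1 <> x :> nat) -> word_product w x = x.
Proof.
elim: w => [|i w IH] h; first by rewrite /word_product big_nil perm1.
rewrite word_product_cons permM.
have -> : simple_reflection i x = x.
  apply: ord_inj; rewrite simple_reflectionE /swap_succ.
  have [/eqP h1 /eqP h2] := h i (mem_head _ _).
  by rewrite [nat_of_ord x == _]eq_sym (negPf h1) [nat_of_ord x == _]eq_sym (negPf h2).
by apply: IH => j jw; apply: h; rewrite inE jw orbT.
Qed.

Lemma word_product_leq w k x :
  (forall i, i \in w -> i <> k :> nat) -> (word_product w x <= k) = (x <= k).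
Proof.
elim: w x => [|i w IH] x h; first by rewrite /word_product big_nil perm1.
rewrite word_product_cons permM IH => [|j jw]; last by apply: h; rewrite inE jw orbT.
rewrite simple_reflectionE /swap_succ.
have := h i (mem_head _ _); do 2?case: eqP; lia.
Qed.

Lemma word_split (T : eqType) (s : seq T) z : z \in s ->
  uniq s -> exists s1 s2, [/\ s = s1 ++ z :: s2, z \notin s1 & z \notin s2].
Proof.
move=> /splitPr[s1 s2]; rewrite cat_uniq /= => /and3P[_ /norP[h1 _] /andP[h2 _]].
by exists s1, s2.
Qed.

Lemma coxeter_word_uniq w : perm_eq w (enum 'I_n) -> uniq w /\ (forall i, i \in w).
Proof.
by move=> h; rewrite (perm_uniq h) enum_uniq; split=> // i; rewrite (perm_mem h) mem_enum.
Qed.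

(** The letters before s_i fix the point j, s_i sends it to i, and the later letters, none of which
    is s_i, preserve {0, ..., i}. *)
Lemma word_product_lt w i j : perm_eq w (enum 'I_n) -> j = i.+1 :> nat ->
  index i w < index j w -> word_product w (ord_low j) < j.
Proof.
move=> /coxeter_word_uniq[uw aw] ij lt.
have [w1 [w2 [ew i1 i2]]] := word_split (aw i) uw.
have j1 : j \notin w1.
  apply/negP => j1; move: lt; rewrite ew !index_cat j1 (negPf i1) /= eqxx /=.
  by rewrite addn0 ltnNge ltnW // index_mem.
rewrite ew word_product_cat word_product_cons !permM (@word_product_fix w1); last first.
  move=> k k1 /=; split=> e; first by case/negP: j1; rewrite -(ord_inj e : k = j).
  by case/negP: i1; rewrite -(_ : k = i) //; apply: ord_inj => /=; lia.
rewrite ij ltnS word_product_leq.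
  rewrite simple_reflectionE /swap_succ /=; do 2?case: eqP; lia.
by move=> k k2 e; case/negP: i2; rewrite -(ord_inj e : k = i).
Qed.

Lemma word_product_gt w i j : perm_eq w (enum 'I_n) -> j = i.+1 :> nat ->
  index j w < index i w -> j < word_product w (ord_low j).
Proof.
move=> /coxeter_word_uniq[uw aw] ij lt.
have [w1 [w2 [ew j1 j2]]] := word_split (aw j) uw.
have i1 : i \notin w1.
  apply/negP => i1; move: lt; rewrite ew !index_cat i1 (negPf j1) /= eqxx /=.
  by rewrite addn0 ltnNge ltnW // index_mem.
rewrite ew word_product_cat word_product_cons !permM (@word_product_fix w1); last first.
  move=> k k1 /=; split=> e; first by case/negP: j1; rewrite -(ord_inj e : k = j).
  by case/negP: i1; rewrite -(_ : k = i) //; apply: ord_inj => /=; lia.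
rewrite ltnNge word_product_leq.
  rewrite simple_reflectionE /swap_succ /=; do 2?case: eqP; lia.
by move=> k k2 e; case/negP: j2; rewrite -(ord_inj e : k = j).
Qed.

Lemma coxeter_sign_word w i j : perm_eq w (enum 'I_n) -> j = i.+1 :> nat ->
  coxeter_sign (word_product w) j = (index i w < index j w).
Proof.
move=> pw ij; rewrite /coxeter_sign.
have -> : inord j = ord_low j by apply: ord_inj; rewrite /= inordK // ltnS ltnW.
have [h|h|h] := ltngtP (index i w) (index j w).
- exact: word_product_lt h.
- by apply/negbTE; rewrite -leqNgt ltnW //; apply: word_product_gt h.
- have [_ aw] := coxeter_word_uniq pw; have := nth_index i (aw i).
  by rewrite h nth_index // => e; move: ij; rewrite e; lia.
Qed.

(* A word omitting the letter k would preserve [{0, ..., k}]. *)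
Lemma coxeter_word_full w0 w : perm_eq w0 (enum 'I_n) ->
  word_product w = word_product w0 -> forall k, k \in w.
Proof.
move=> p0 gw k; have [u0 a0] := coxeter_word_uniq p0.
apply/negPn/negP => kn.
have [w1 [w2 [ew k1 k2]]] := word_split (a0 k) u0.
have nk (v : seq 'I_n) : k \notin v -> forall l, l \in v -> l <> k :> nat.
  by move=> kv l lv e; case/negP: kv; rewrite -(ord_inj e : l = k).
pose y := (word_product w1)^-1%g (ord_low k).
have yk : y <= k.
  by rewrite -(word_product_leq (w := w1)) ?permKV //; apply: nk.
have : word_product w y <= k by rewrite word_product_leq //; apply: nk.
rewrite gw ew word_product_cat word_product_cons !permM permKV.
rewrite word_product_leq ?simple_reflectionE /swap_succ /= ?eqxx ?ltnn //.
exact: nk.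
Qed.

Lemma coxeter_word_reduced w : perm_eq w (enum 'I_n) -> reduced_word w.
Proof.
move=> pw w' e; have [uw _] := coxeter_word_uniq pw; apply: uniq_leq_size => // k _.
exact: coxeter_word_full pw e k.
Qed.

(** [is_initial] allows any reduced word. Such a word contains every letter by [coxeter_word_full]
    and has at most n letters, so it uses each exactly once. *)
Lemma initial_coxeter_word i g : is_coxeter_element g -> is_initial i g ->
  exists w, perm_eq (i :: w) (enum 'I_n) /\ g = word_product (i :: w).
Proof.
move=> [w0 [p0 g0]] [w [red gw]]; exists w; split=> //.
have all k : k \in i :: w by apply: coxeter_word_full p0 _ k; rewrite -g0.
have sz : size (i :: w) <= size (enum 'I_n).
  by rewrite -(perm_size p0); apply: red; rewrite -gw.
have uw : uniq (i :: w) by apply: leq_size_uniq sz; [exact: enum_uniq|].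
by apply: uniq_perm => // [|k]; rewrite ?enum_uniq // all mem_enum.
Qed.
End Coxeter.

Lemma index_rev_lt (T : eqType) (s : seq T) x y :
  uniq s -> x \in s -> y \in s ->
  (index x (rev s) < index y (rev s)) = (index y s < index x s).
Proof.
move=> us; have idx z : z \in s -> index z (rev s) = size s - (index z s).+1.
  move=> zs; have lt : index z s < size s by rewrite index_mem.
  have {1}-> : z = nth z (rev s) (size s - (index z s).+1).
    by rewrite nth_rev ?subnSK ?subKn ?nth_index // ?leq_subr //; lia.
  by rewrite index_uniq ?rev_uniq // size_rev; lia.
by move=> xs ys; rewrite !idx //; move: xs ys; rewrite -!index_mem; lia.
Qed.

(** * Conjugation by initial letters, and powers of a Coxeter element *)

Section CoxeterMoves.
Variable n : nat.
Implicit Types (i j : 'I_n) (x : 'I_n.+1) (w : seq 'I_n) (g : 'S_n.+1).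

Lemma perm_enum_rcons i w :
  perm_eq (i :: w) (enum 'I_n) -> perm_eq (rcons w i) (enum 'I_n).
Proof. by apply: perm_trans; rewrite perm_rcons. Qed.

Lemma coxeter_sign_initial i w : perm_eq (i :: w) (enum 'I_n) ->
  (0 < i -> coxeter_sign (word_product (i :: w)) i = false) /\
  (i.+1 < n -> coxeter_sign (word_product (i :: w)) i.+1 = true).
Proof.
move=> pw; split=> hi.
  have h : i.-1 < n by rewrite (leq_ltn_trans (leq_pred _)).
  rewrite (@coxeter_sign_word _ _ (Ordinal h) i) //=; last by rewrite prednK.
  by rewrite eqxx ltn0.
rewrite (@coxeter_sign_word _ _ i (Ordinal hi)) //= eqxx.
by case: eqP => // e; have := congr1 val e => /=; lia.
Qed.

(** The sign at k compares the letters k - 1 and k, so moving the letter i from front to back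
    affects only the two comparisons in which it takes part. *)
Lemma coxeter_sign_rcons i w k : perm_eq (i :: w) (enum 'I_n) -> 0 < k < n ->
  coxeter_sign (word_product (rcons w i)) k =
  if (k == i) || (k == i.+1) then ~~ coxeter_sign (word_product (i :: w)) k
  else coxeter_sign (word_product (i :: w)) k.
Proof.
move=> pw /andP[k0 kn]; have pw' := perm_enum_rcons pw.
have h : k.-1 < n by rewrite (leq_ltn_trans (leq_pred _)).
have e : Ordinal kn = (Ordinal h).+1 :> nat by rewrite /= prednK.
rewrite -[k]/(nat_of_ord (Ordinal kn)) !(coxeter_sign_word _ e) //.
have [/= /andP[iw uw] aw] := coxeter_word_uniq pw.
have idx j : j != i -> index j (rcons w i) = index j w /\ index j w < size w.
  move=> ji; have : j \in w by have := aw j; rewrite inE (negPf ji).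
  by move=> jw; rewrite index_mem -cats1 index_cat jw.
have idi : index i (rcons w i) = size w.
  by rewrite -cats1 index_cat (negPf iw) /= eqxx addn0.
have ne : Ordinal h != Ordinal kn by rewrite -val_eqE /=; lia.
case: (eqVneq (Ordinal kn) i) => [ki|ki].
  have ni : Ordinal h != i by rewrite -ki.
  have [-> lt] := idx _ ni; rewrite ki idi -ki lt /= !eqxx //.
case: (eqVneq (Ordinal h) i) => [hi|hi].
  have [-> lt] := idx _ ki; rewrite hi idi -hi /= prednK // !eqxx orbT /=.
  by rewrite ltnNge ltnW.
have [-> _] := idx _ ki; have [-> _] := idx _ hi.
rewrite ltnS.
rewrite ifF //; apply/negbTE; move: ki hi; rewrite -!val_eqE /=; lia.
Qed.

Lemma conj_word_product i w :
  (simple_reflection i * word_product (i :: w) * simple_reflection i)%g =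
  word_product (rcons w i).
Proof.
rewrite word_product_cons mulgA simple_reflectionK mul1g -cats1 word_product_cat.
by rewrite word_product_cons [word_product [::]]big_nil mulg1.
Qed.

Lemma roots_compatible_initial i w a b k l : perm_eq (i :: w) (enum 'I_n) ->
  a <= n -> b <= n -> k <= n -> l <= n ->
  almost_positive a b -> almost_positive k l -> (a, b) != (k, l) ->
  roots_compatible (coxeter_sign (word_product (i :: w))) a b k l =
  roots_compatible (coxeter_sign (word_product (rcons w i)))
    (tau_index i a b).1 (tau_index i a b).2 (tau_index i k l).1 (tau_index i k l).2.
Proof.
move=> pw an bn kn ln vab vkl ne.
set e := coxeter_sign _; set e' := coxeter_sign _.
have [ei ei1] := coxeter_sign_initial pw.
(* When i = 0 or i + 1 = n the sign there means nothing. [roots_compatible_ext] lets it take the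
   value that [roots_compatible_tau] expects, which avoids boundary cases. *)
pose f (j : nat) := if j == i then false else if j == i.+1 then true else e j.
pose f' (j : nat) := if (j == i) || (j == i.+1) then ~~ f j else f j.
have swap_le (x : nat) : x <= n -> swap_succ i x <= n.
  by rewrite /swap_succ; have := ltn_ord i; case: ifP => // _; case: ifP => // _; lia.
have tau_le (x y : nat) : x <= n -> y <= n -> (tau_index i x y).1 <= n /\ (tau_index i x y).2 <= n.
  move=> hx hy; rewrite /tau_index; case: ifP => //= _.
  by split; apply: swap_le.
have [t1 t2] := tau_le a b an bn; have [t3 t4] := tau_le k l kn ln.
rewrite (@roots_compatible_ext n e f) //; last first.
  move=> j /andP[j0 jn]; rewrite /f; case: eqP => [ji|_]; first by rewrite ji /e ei // -ji.
  by case: eqP => // ji; rewrite ji /e ei1 // -ji.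
rewrite (@roots_compatible_ext n e' f') //; last first.
  move=> j hj; rewrite /e' coxeter_sign_rcons //; case/andP: hj => j0 jn.
  rewrite /f' /f -/e; case: eqP => [ji|_] /=; first by rewrite ji /e ei // -ji.
  by case: eqP => //= ji; rewrite ji /e ei1 // -ji.
apply: roots_compatible_tau => //.
- by rewrite /f eqxx.
- by rewrite /f eqxx; case: eqP; lia.
Qed.

Lemma word_product_rev w : word_product (rev w) = (word_product w)^-1%g.
Proof.
elim: w => [|i w IH]; first by rewrite /word_product !big_nil invg1.
rewrite rev_cons -cats1 word_product_cat IH !word_product_cons invMg.
by rewrite [word_product [::]]big_nil mulg1 /simple_reflection tpermV.
Qed.

(** For x < n the order of the letters x - 1 and x decides whether the element or its inverse lowers
    x. The point n is moved only by the letter n - 1, which lowers it. *)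
Lemma coxeter_descends w x : perm_eq w (enum 'I_n) -> 0 < x ->
  exists m, (word_product w ^+ m)%g x < x.
Proof.
move=> pw x0; have [uw aw] := coxeter_word_uniq pw.
have hi : x.-1 < n by have := ltn_ord x; lia.
case: (ltnP x n) => xn; last first.
  exists 1; rewrite expg1.
  have [w1 [w2 [ew i1 i2]]] := word_split (aw (Ordinal hi)) uw.
  rewrite ew word_product_cat word_product_cons !permM (@word_product_fix _ w1); last first.
    move=> k k1; have := ltn_ord k; have := ltn_ord x; split; first lia.
    by move=> e; case/negP: i1; rewrite -(_ : k = Ordinal hi) //; apply: ord_inj => /=; lia.
  rewrite -[X in _ < X]prednK // ltnS word_product_leq.
    by rewrite simple_reflectionE /swap_succ /=; do 2?case: eqP; lia.
  by move=> k k2 e; case/negP: i2; rewrite -(_ : k = Ordinal hi) //; apply: ord_inj.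
have e : Ordinal xn = (Ordinal hi).+1 :> nat by rewrite /= prednK.
have ex : x = ord_low (Ordinal xn) by apply: ord_inj.
have [h|h|h] := ltngtP (index (Ordinal hi) w) (index (Ordinal xn) w).
- by exists 1; rewrite expg1 {1}ex; apply: word_product_lt h.
(* Finite order makes the inverse a power; it is given by the reversed word, in which x - 1 does
   come before x. *)
- exists (#[word_product w]%g).-1; rewrite -invg_expg -word_product_rev {1}ex.
  have pw' : perm_eq (rev w) (enum 'I_n) by rewrite perm_rev.
  by apply: (word_product_lt pw' e); rewrite index_rev_lt.
- by have := nth_index (Ordinal hi) (aw (Ordinal hi)); rewrite h nth_index // => /(congr1 val) /=; lia.
Qed.
End CoxeterMoves.

(** * Roots and uniqueness of the compatibility family *)

Section Roots.
Variables (R : realType) (n : nat).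
Implicit Types (a b k l x : 'I_n.+1) (i j : 'I_n).
Local Open Scope ring_scope.

Definition rootv a b : 'rV[R]_n.+1 := delta_mx 0 a - delta_mx 0 b.

Lemma root_coord a b x : rootv a b 0 x = (x == a)%:R - (x == b)%:R.
Proof. by rewrite !mxE eqxx. Qed.

Lemma root_inj a b k l : a != b -> rootv a b = rootv k l -> a = k /\ b = l.
Proof.
move=> ab e; have := congr1 (fun v : 'rV[R]_n.+1 => v 0 a) e.
have := congr1 (fun v : 'rV[R]_n.+1 => v 0 b) e.
clear e; rewrite /= !root_coord !eqxx [b == a]eq_sym (negPf ab).
case: (eqVneq a k) => [<-|_]; case: (eqVneq b l) => [<-|_] //=;
  case: (_ == _); case: (_ == _) => /= h1 h2; exfalso; lra.
Qed.

Lemma simple_rootE i : simple_root R i = rootv (ord_low i) (ord_high i).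
Proof. by []. Qed.

Lemma opp_simple_root i : - simple_root R i = rootv (ord_high i) (ord_low i).
Proof. by rewrite /simple_root opprB. Qed.

Lemma ord_highE i : ord_high i = i.+1 :> nat.
Proof. by rewrite /= /bump leq0n add1n. Qed.

Lemma almost_positive_neq a b : almost_positive a b -> a != b.
Proof. by rewrite /almost_positive -val_eqE /=; lia. Qed.

Lemma negative_index a b : a = b.+1 :> nat -> exists i, a = ord_high i /\ b = ord_low i.
Proof.
move=> ab; have h : (b < n)%N by have := ltn_ord a; rewrite ab.
by exists (Ordinal h); split; apply: ord_inj; rewrite ?ord_highE.
Qed.

Lemma almost_positive_rootP (v : 'rV[R]_n.+1) :
  almost_positive_root v <-> exists a b, almost_positive a b /\ v = rootv a b.
Proof.
split=> [[[a [b [ab ->]]]|[i ->]]|[a [b [/orP[ab|/eqP ab] ->]]]].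
- by exists a, b; rewrite /almost_positive ab.
- exists (ord_high i), (ord_low i); split; last exact: opp_simple_root.
  by rewrite /almost_positive ord_highE eqxx orbT.
- by left; exists a, b.
- by right; have [i [-> ->]] := negative_index ab; exists i; rewrite opp_simple_root.
Qed.

Definition tau_ord i a b : 'I_n.+1 * 'I_n.+1 :=
  if (b < a)%N && (b != i :> nat) then (a, b)
  else (simple_reflection i a, simple_reflection i b).

Lemma tau_ordE i a b :
  ((tau_ord i a b).1 : nat, (tau_ord i a b).2 : nat) = tau_index i a b.
Proof. by rewrite /tau_ord /tau_index; case: ifP => //= _; rewrite !simple_reflectionE. Qed.

Lemma col_perm_root i a b :
  col_perm (simple_reflection i) (rootv a b) =
  rootv (simple_reflection i a) (simple_reflection i b).
Proof.
have h x y : (simple_reflection i x == y) = (x == simple_reflection i y).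
  by rewrite -(inj_eq (@perm_inj _ (simple_reflection i))) -permM simple_reflectionK perm1.
by apply/rowP => x; rewrite mxE !root_coord !h.
Qed.

Lemma tau_root i a b : almost_positive a b ->
  tau i (rootv a b) = rootv (tau_ord i a b).1 (tau_ord i a b).2.
Proof.
move=> vab; rewrite /tau /tau_ord.
have -> : [exists j : 'I_n, (j != i) && (rootv a b == - simple_root R j)] =
    (b < a)%N && (b != i :> nat).
  apply/existsP/andP => [[j /andP[ji /eqP]]|[ba bi]].
    rewrite opp_simple_root => /root_inj[]; first exact: almost_positive_neq.
    by move=> -> ->; rewrite ord_highE ltnSn.
  have [|j [ea eb]] := @negative_index a b; first by move: vab; rewrite /almost_positive; lia.
  exists j; rewrite opp_simple_root ea eb eqxx andbT.
  by apply: contraNneq bi => <-; rewrite eb.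
by case: ifP => // _; rewrite col_perm_root.
Qed.

Lemma tau_index_almost_positive (i a b : nat) :
  almost_positive a b -> almost_positive (tau_index i a b).1 (tau_index i a b).2.
Proof.
rewrite /almost_positive /tau_index /swap_succ; case: ifP => //= h h'.
by do 4?case: eqP; lia.
Qed.

Lemma tau_index_involutive (i a b : nat) : almost_positive a b ->
  tau_index i (tau_index i a b).1 (tau_index i a b).2 = (a, b).
Proof.
rewrite /almost_positive /tau_index; case: (boolP ((b < a)%N && (b != i))) => h h' /=.
  by rewrite h.
have sK (x : nat) : swap_succ i (swap_succ i x) = x.
  case: (swap_succ_cases i x) => [[-> ->]|[-> ->]|[_ _ e]]; last by rewrite !e.
    by rewrite /swap_succ eqxx; case: eqP; lia.
  by rewrite /swap_succ eqxx.
rewrite !sK ifF //; move: h h'.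
by case: (swap_succ_cases i a) => -[A1 A2]; try move=> A3;
   case: (swap_succ_cases i b) => -[B1 B2]; try move=> B3; lia.
Qed.

Lemma tau_ord_almost_positive i a b :
  almost_positive a b -> almost_positive (tau_ord i a b).1 (tau_ord i a b).2.
Proof. by move/(tau_index_almost_positive i); rewrite -tau_ordE. Qed.

Lemma tau_ord_neq i a b k l : almost_positive a b -> almost_positive k l ->
  (a, b) != (k, l) -> tau_ord i a b != tau_ord i k l.
Proof.
move=> vab vkl; apply: contraNneq => e.
have : tau_index i a b = tau_index i k l by rewrite -!tau_ordE e.
move=> e'; have := tau_index_involutive i vab; rewrite e' tau_index_involutive // => -[h1 h2].
by rewrite xpair_eqE -!val_eqE /= h1 h2 !eqxx.
Qed.

Lemma sum_simple_roots b : \sum_(i < n | (i < b)%N) simple_root R i = rootv ord0 b.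
Proof.
case: b => b hb; elim: b hb => [|b IH] hb.
  by rewrite big_pred0 // /rootv (_ : Ordinal hb = ord0) ?subrr //; apply: ord_inj.
have bn : (b < n)%N by rewrite ltnS in hb.
rewrite (bigD1 (Ordinal bn)) //= (eq_bigl (fun i : 'I_n => (i < Ordinal (ltnW hb))%N)).
  rewrite IH simple_rootE /rootv addrC addrA.
  have -> : ord_low (Ordinal bn) = Ordinal (ltnW hb) by apply: ord_inj.
  have -> : ord_high (Ordinal bn) = Ordinal hb by apply: ord_inj; rewrite ord_highE.
  by rewrite subrK.
by move=> i /=; rewrite -val_eqE /=; lia.
Qed.

Lemma sum_simple_roots_interval a b : (a <= b)%N ->
  \sum_(i < n | (a <= i < b)%N) simple_root R i = rootv a b.
Proof.
move=> ab; have := sum_simple_roots b.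
rewrite (bigID (fun i : 'I_n => (i < a)%N)) /=.
rewrite (eq_bigl (fun i : 'I_n => (i < a)%N)) => [|i]; last by lia.
rewrite sum_simple_roots => /(canRL (addKr _)) h.
rewrite (eq_bigl (fun i : 'I_n => (i < b)%N && ~~ (i < a)%N)) => [|i]; last by lia.
by rewrite h /rootv opprB addrA subrK.
Qed.

Lemma simple_roots_free : free (simple_roots R n).
Proof.
apply/freeP => c c0 i.
have nthE j : (simple_roots R n)`_j = simple_root R j by rewrite -tnth_nth tnth_mktuple.
(* The sum of the coordinates 0, ..., i vanishes on every simple root except alpha_i, so it extracts
   the coefficient [c i]. *)
have : \sum_(x < n.+1 | (x <= i)%N) (\sum_(j < n) c j *: (simple_roots R n)`_j) 0 x = 0.
  by rewrite c0 big1 // => x _; rewrite mxE.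
under eq_bigr => x _ do rewrite summxE.
rewrite exchange_big /= (bigD1 i) //= [X in _ + X]big1 ?addr0 => [|j ji].
  rewrite (bigD1 (ord_low i)) //= big1 ?addr0 => [|x /andP[xi xne]].
    rewrite nthE simple_rootE !mxE /= !eqxx /=.
    by rewrite -val_eqE /= /bump leq0n add1n ltn_eqF // subr0 mulr1.
  rewrite nthE simple_rootE !mxE /= (negPf xne).
  by rewrite -val_eqE /= /bump leq0n add1n ltn_eqF ?subrr ?mulr0 // ltnS.
under eq_bigr => x _ do rewrite nthE simple_rootE !mxE /=.
rewrite -big_distrr /= sumrB.
have e y : \sum_(x < n.+1 | (x <= i)%N) ((x == y)%:R : R) = (y <= i)%N%:R.
  case: (boolP (y <= i)%N) => yi.
    by rewrite (bigD1 y) //= eqxx big1 ?addr0 // => x /andP[_ /negPf ->].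
  by rewrite big1 // => x xi; case: eqP xi yi => // -> ->.
rewrite !e /= /bump leq0n add1n.
have -> : (j < i)%N = (j <= i)%N by rewrite ltn_neqAle -val_eqE in ji *; rewrite ji.
by rewrite subrr mulr0.
Qed.

Lemma coord_root i a b :
  coord (simple_roots R n) i (rootv a b) = (i < b)%N%:R - (i < a)%N%:R.
Proof.
have nthE j : (simple_roots R n)`_j = simple_root R j by rewrite -tnth_nth tnth_mktuple.
have e y : coord (simple_roots R n) i (rootv ord0 y) = (i < y)%N%:R.
  rewrite -sum_simple_roots big_mkcond /=.
  rewrite (eq_bigr (fun j : 'I_n => (j < y)%N%:R *: (simple_roots R n)`_j)) => [|j _].
    by rewrite coord_sum_free ?simple_roots_free.
  by rewrite nthE; case: ifP; rewrite ?scale1r ?scale0r.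
have -> : rootv a b = rootv ord0 b - rootv ord0 a.
  by rewrite /rootv opprB [RHS]addrC addrA subrK.
by rewrite linearB /= !e.
Qed.
End Roots.

(** * Existence and uniqueness of the compatibility family *)

Section CompatibilityFamily.
Variables (R : realType) (n : nat).
Implicit Types (a b k l x : 'I_n.+1) (i j : 'I_n) (g : 'S_n.+1).

Definition root_compatible g (v w : 'rV[R]_n.+1) : Prop :=
  exists a b k l, [/\ almost_positive a b, almost_positive k l,
    v = rootv R a b, w = rootv R k l & roots_compatible (coxeter_sign g) a b k l].

Lemma root_compatibleE g a b k l : almost_positive a b -> almost_positive k l ->
  root_compatible g (rootv R a b) (rootv R k l) <->
  roots_compatible (coxeter_sign g) a b k l.
Proof.
move=> vab vkl; split=> [|h]; last by exists a, b, k, l.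
move=> [a' [b' [k' [l' [h1 h2 e1 e2]]]]].
have [-> ->] := root_inj (almost_positive_neq vab) e1.
by have [-> ->] := root_inj (almost_positive_neq vkl) e2.
Qed.

Lemma coord_root_eq0 i k l (eps : nat -> bool) : almost_positive k l ->
  rootv R k l <> (- simple_root R i)%R ->
  (coord (simple_roots R n) i (rootv R k l) = 0)%R <->
  roots_compatible eps (ord_high i) (ord_low i) k l.
Proof.
move=> vkl ne; rewrite coord_root /roots_compatible ord_highE /= ltnSn.
case: (ltnP l k) => lk /=.
  split=> // _; have [|j [ek el]] := @negative_index _ k l.
    by move: vkl; rewrite /almost_positive; lia.
  have ij : i != j by apply: contra_notN ne => /eqP ->; rewrite opp_simple_root ek el.
  rewrite ek el ord_highE /= ltnS [(i <= j)%N]leq_eqVlt -val_eqE /= in ij *.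
  by rewrite (negPf ij) subrr.
case: (ltnP i l) => il; case: (ltnP i k) => ik /=.
- by rewrite subrr.
- by rewrite subr0; split=> // /eqP; rewrite oner_eq0.
- by lia.
- by rewrite subrr.
Qed.

Lemma initial_conj i g : is_coxeter_element g -> is_initial i g -> exists w,
  [/\ perm_eq (i :: w) (enum 'I_n), g = word_product (i :: w) &
      (simple_reflection i * g * simple_reflection i)%g = word_product (rcons w i)].
Proof.
move=> cg ig; have [w [pw gw]] := initial_coxeter_word cg ig.
by exists w; split=> //; rewrite gw conj_word_product.
Qed.

Lemma root_compatible_family : is_compatibility_family root_compatible.
Proof.
move=> g cg; split.
- move=> _ _ /almost_positive_rootP[a [b [vab ->]]] /almost_positive_rootP[k [l [vkl ->]]] _.
  by rewrite !root_compatibleE // roots_compatible_sym.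
- move=> i _ /almost_positive_rootP[k [l [vkl ->]]] ne.
  rewrite opp_simple_root root_compatibleE //; last first.
    by rewrite /almost_positive ord_highE eqxx orbT.
  by rewrite (coord_root_eq0 (coxeter_sign g)).
- move=> i ig _ _ /almost_positive_rootP[a [b [vab ->]]] /almost_positive_rootP[k [l [vkl ->]]] ne.
  have [w [pw gw ->]] := initial_conj cg ig.
  rewrite !tau_root // !root_compatibleE //; try exact: tau_ord_almost_positive.
  rewrite gw (roots_compatible_initial pw) ?leq_ord // -?tau_ordE //=.
  by apply/eqP => -[e1 e2]; case: ne; rewrite (ord_inj e1) (ord_inj e2).
Qed.

Section Uniqueness.
Variable Q : 'S_n.+1 -> 'rV[R]_n.+1 -> 'rV[R]_n.+1 -> Prop.
Hypothesis famQ : is_compatibility_family Q.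

(** The second root is quantified away, so that the descent only has to follow the first. *)
Let disagree g a b := exists k l, [/\ almost_positive a b, almost_positive k l,
  (a, b) != (k, l) &
  ~ (Q g (rootv R a b) (rootv R k l) <-> roots_compatible (coxeter_sign g) a b k l)].

Let root_neq a b k l : almost_positive a b -> (a, b) != (k, l) -> rootv R a b <> rootv R k l.
Proof.
move=> vab ne e; have [h1 h2] := root_inj (almost_positive_neq vab) e.
by rewrite h1 h2 eqxx in ne.
Qed.

(** Axiom (i) settles every pair whose first root is negative. *)
Let disagree_pos w a b : perm_eq w (enum 'I_n) ->
  disagree (word_product w) a b -> (a < b)%N.
Proof.
move=> pw [k [l [vab vkl ne h]]]; rewrite ltnNge; apply/negP => ba; apply: h.
have [|i [ea eb]] := @negative_index _ a b; first by move: vab; rewrite /almost_positive; lia.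
have cg : is_coxeter_element (word_product w) by exists w.
have [_ neg _] := famQ cg.
have ne' : rootv R k l <> (- simple_root R i)%R.
  by rewrite opp_simple_root -ea -eb => /esym; apply: root_neq.
rewrite ea eb -opp_simple_root neg //; first exact: coord_root_eq0.
by apply/almost_positive_rootP; exists k, l.
Qed.

(** The first root is positive by [disagree_pos], so [tau] acts on it as the permutation s_i itself.
    Successive letters then compose to the action of a group element. *)
Let disagree_step i w a b : perm_eq (i :: w) (enum 'I_n) ->
  disagree (word_product (i :: w)) a b ->
  disagree (word_product (rcons w i)) (simple_reflection i a) (simple_reflection i b).
Proof.
move=> pw dis; have ab := disagree_pos pw dis.
have tab : tau_ord i a b = (simple_reflection i a, simple_reflection i b).
  by rewrite /tau_ord ltnNge ltnW.
move: dis => [k [l [vab vkl ne h]]].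
exists (tau_ord i k l).1, (tau_ord i k l).2; split.
- by have := tau_ord_almost_positive i vab; rewrite tab.
- exact: tau_ord_almost_positive.
- by rewrite -surjective_pairing -tab tau_ord_neq.
move=> h'; apply: h.
have cg : is_coxeter_element (word_product (i :: w)) by exists (i :: w).
have ig : is_initial i (word_product (i :: w)).
  by exists w; split=> //; apply: coxeter_word_reduced.
have [_ _ /(_ i ig)] := famQ cg.
move=> /(_ (rootv R a b) (rootv R k l)) -> //; first last.
- exact: root_neq.
- by apply/almost_positive_rootP; exists k, l.
- by apply/almost_positive_rootP; exists a, b.
rewrite conj_word_product !tau_root // tab /= h'.
rewrite (roots_compatible_initial pw) ?leq_ord // -?tau_ordE ?tab //=.
Qed.

Let disagree_cat u v a b : perm_eq (u ++ v) (enum 'I_n) ->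
  disagree (word_product (u ++ v)) a b ->
  disagree (word_product (v ++ u)) (word_product u a) (word_product u b).
Proof.
elim: u v a b => [|i u IH] v a b pw.
  by rewrite cats0 /word_product big_nil !perm1.
move/(disagree_step pw); rewrite rcons_cat => /IH.
rewrite cat_rcons !word_product_cons !permM; apply.
by rewrite -rcons_cat; apply: perm_enum_rcons.
Qed.

Let disagree_expg w m a b : perm_eq w (enum 'I_n) ->
  disagree (word_product w) a b ->
  disagree (word_product w) ((word_product w ^+ m)%g a) ((word_product w ^+ m)%g b).
Proof.
move=> pw dis; elim: m => [|m IH]; first by rewrite expg0 !perm1.
have := @disagree_cat w [::] ((word_product w ^+ m)%g a) ((word_product w ^+ m)%g b).
rewrite cats0 => /(_ pw IH).
by rewrite -!permM -!expgSr.
Qed.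

(* Moving both roots along [g] preserves any disagreement with [Q], while
   iterating [g] eventually sends [b] below [a]. *)
Let no_disagreement w a b : perm_eq w (enum 'I_n) -> ~ disagree (word_product w) a b.
Proof.
move=> pw; have [N] := ubnP (nat_of_ord b); elim: N a b => // N IH a b bN dis.
have ab := disagree_pos pw dis.
have [m lt] := coxeter_descends pw (leq_ltn_trans (leq0n a) ab).
by apply: (IH _ _ _ (disagree_expg m pw dis)); apply: leq_trans lt _; rewrite -ltnS.
Qed.

Lemma compatibility_family_unique w a b k l : perm_eq w (enum 'I_n) ->
  almost_positive a b -> almost_positive k l -> (a, b) != (k, l) ->
  Q (word_product w) (rootv R a b) (rootv R k l) <->
  roots_compatible (coxeter_sign (word_product w)) a b k l.
Proof.
move=> pw vab vkl ne; apply: contrapT => h.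
by apply: (@no_disagreement w a b pw); exists k, l.
Qed.
End Uniqueness.

Lemma c_compatibleE w a b k l : perm_eq w (enum 'I_n) ->
  almost_positive a b -> almost_positive k l -> (a, b) != (k, l) ->
  c_compatible (word_product w) (rootv R a b) (rootv R k l) <->
  roots_compatible (coxeter_sign (word_product w)) a b k l.
Proof.
move=> pw vab vkl ne; split=> [[Q [famQ]]|h].
  by rewrite (compatibility_family_unique famQ pw).
by exists root_compatible; split; [exact: root_compatible_family|rewrite root_compatibleE].
Qed.
End CompatibilityFamily.

(** * Chords of a convex polygon *)

Section ConvexPolygon.
Variables (R : realType) (n : nat) (p : 'I_n.+3 -> (R * R)%type).
Hypothesis hp : convex_polygon p.
Implicit Types (a b c d : 'I_n.+3).
Local Open Scope ring_scope.

Lemma orient_rot (u v w : R * R) : orient u v w = orient v w u.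
Proof. rewrite /orient; ring. Qed.

Lemma orient_swap (u v w : R * R) : orient u w v = - orient u v w.
Proof. rewrite /orient; ring. Qed.

Lemma orient_cyclic a b c : cyclic a b c -> 0 < orient (p a) (p b) (p c).
Proof.
case/or3P => /andP[h1 h2]; first exact: hp.
  by rewrite orient_rot; apply: hp.
by rewrite 2!orient_rot; apply: hp.
Qed.

Lemma orient_pos a b c : (0 < orient (p a) (p b) (p c)) = cyclic a b c.
Proof.
apply/idP/idP; last exact: orient_cyclic.
apply: contraTT => h; rewrite -leNgt.
have [e|ab] := eqVneq a b; first by rewrite e /orient; lra.
have [e|bc] := eqVneq b c; first by rewrite e /orient; lra.
have [e|ac] := eqVneq a c; first by rewrite e /orient; lra.
rewrite -oppr_ge0 -orient_swap ltW // orient_cyclic //.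
move: h ab bc ac; rewrite -!val_eqE /cyclic /=; lia.
Qed.

Lemma orient_neg a b c : (orient (p a) (p b) (p c) < 0) = cyclic a c b.
Proof. by rewrite -orient_pos (orient_swap (p a) (p b)) oppr_gt0. Qed.

Lemma eq_set2 (T : finType) (a b c d : T) : [set a; b]%SET = [set c; d]%SET ->
  (a = c /\ b = d) \/ (a = d /\ b = c).
Proof.
move=> e; have ha := set21 a b; have hb := set22 a b.
have hc := set21 c d; have hd := set22 c d.
rewrite e !inE in ha hb; rewrite -e !inE in hc hd.
case/orP: ha => /eqP ha; case/orP: hb => /eqP hb; case/orP: hc => /eqP hc;
  case/orP: hd => /eqP hd; subst; auto.
Qed.

Lemma segment_interiorE a b (x : R * R) : a != b ->
  segment_interior p [set a; b]%SET x <->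
  exists2 t, 0 < t < 1 &
    x = ((1 - t) * (p a).1 + t * (p b).1, (1 - t) * (p a).2 + t * (p b).2).
Proof.
move=> ab; split=> [[a' [b' [t [ab' /eq_set2 e ht ->]]]]|[t ht ->]]; last first.
  by exists a, b, t.
case: e => -[-> ->]; first by exists t.
by exists (1 - t); [lra|congr pair; ring].
Qed.

(** A point of cd on the line ab makes a positive combination of the orientations of abc and abd
    vanish. If the ends did not alternate, these would have the same weak sign and not both be
    zero. *)
Lemma crosses_chords_cross a b c d : a != b -> c != d ->
  crosses p [set a; b]%SET [set c; d]%SET -> chords_cross a b c d.
Proof.
move=> ab cd [ne [x [/(segment_interiorE _ ab)[t ht ex] /(segment_interiorE _ cd)[s hs ex']]]].
have {ex ex'} e : orient (p a) (p b)
    ((1 - s) * (p c).1 + s * (p d).1, (1 - s) * (p c).2 + s * (p d).2) = 0.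
  by rewrite -ex' ex /orient /=; ring.
have {}e : (1 - s) * orient (p a) (p b) (p c) + s * orient (p a) (p b) (p d) = 0.
  by rewrite -e /orient /=; ring.
apply/negPn/negP => nc.
have [[h1 h2 h3]|[h1 h2 h3]] :
  [/\ 0 <= orient (p a) (p b) (p c), 0 <= orient (p a) (p b) (p d) &
      0 < orient (p a) (p b) (p c) \/ 0 < orient (p a) (p b) (p d)] \/
  [/\ orient (p a) (p b) (p c) <= 0, orient (p a) (p b) (p d) <= 0 &
      orient (p a) (p b) (p c) < 0 \/ orient (p a) (p b) (p d) < 0].
- rewrite !orient_pos !orient_neg !leNgt !orient_pos !orient_neg.
  have ne1 : ~ (a = c :> nat /\ b = d :> nat) by case=> /ord_inj ? /ord_inj ?; apply: ne; congruence.
  have ne2 : ~ (a = d :> nat /\ b = c :> nat).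
    by case=> /ord_inj ? /ord_inj ?; apply: ne; subst; rewrite finset.setUC.
  have nc' : ~ chords_cross a b c d by apply/negP.
  have {}ab : a <> b :> nat by move=> /ord_inj e'; rewrite e' eqxx in ab.
  have {}cd : c <> d :> nat by move=> /ord_inj e'; rewrite e' eqxx in cd.
  have [[h1 [h2 h3]]|[h1 [h2 h3]]] :
    (~~ cyclic a c b /\ ~~ cyclic a d b /\ (cyclic a b c \/ cyclic a b d)) \/
    (~~ cyclic a b c /\ ~~ cyclic a b d /\ (cyclic a c b \/ cyclic a d b)).
    move: nc' ne1 ne2 ab cd; clear; rewrite /chords_cross /cyclic; lia.
  + by left.
  + by right.
- move: e h1 h2 h3; case/andP: hs => s0 s1; clear - s0 s1.
  move: (orient _ _ _) (orient _ _ _) => u v e h1 h2 [h|h]; nra.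
- move: e h1 h2 h3; case/andP: hs => s0 s1; clear - s0 s1.
  move: (orient _ _ _) (orient _ _ _) => u v e h1 h2 [h|h]; nra.
Qed.

Lemma chords_cross_crosses a b c d :
  chords_cross a b c d -> crosses p [set a; b]%SET [set c; d]%SET.
Proof.
wlog h : a b / cyclic a c b && cyclic b d a.
  move=> W h; case/orP: (h) => h'; first exact: W.
  by rewrite finset.setUC; apply: W; rewrite 1?andbC // chords_cross_flipl.
move=> _; case/andP: h => h1 h2.
have ab : a != b by apply/eqP => e; move: h1; rewrite e /cyclic; lia.
have cd : c != d by apply/eqP => e; move: h1 h2; rewrite e /cyclic; lia.
split.
  by move/eq_set2 => -[] [e1 e2]; move: h1 h2; rewrite e1 e2 /cyclic; lia.
have o1 := orient_cyclic h1; have o2 := orient_cyclic h2.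
have o3 : 0 < orient (p c) (p b) (p d).
  by apply: orient_cyclic; move: h1 h2; rewrite /cyclic; lia.
have o4 : 0 < orient (p d) (p a) (p c).
  by apply: orient_cyclic; move: h1 h2; rewrite /cyclic; lia.
set A := orient (p a) (p c) (p b) in o1; set B := orient (p b) (p d) (p a) in o2.
set C := orient (p c) (p b) (p d) in o3; set D := orient (p d) (p a) (p c) in o4.
have ratio (u v : R) : 0 < u -> 0 < v -> 0 < u / (u + v) < 1.
  move=> u0 v0; have uv : 0 < u + v by rewrite addr_gt0.
  by rewrite divr_gt0 //= ltr_pdivrMr // mul1r ltrDl.
have AB : A + B = C + D by rewrite /A /B /C /D /orient; ring.
(* A, B, C, D are the doubled areas of the triangles acb, bda, cbd, dac. The intersection point
   divides cd in the ratio A : B and ab in the ratio D : C. *)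
pose t := D / (C + D); pose s := A / (A + B).
exists ((1 - t) * (p a).1 + t * (p b).1, (1 - t) * (p a).2 + t * (p b).2).
split.
  apply/(segment_interiorE _ ab).
  by exists t => //; rewrite /t [C + D]addrC ratio.
apply/(segment_interiorE _ cd); exists s.
  by rewrite /s ratio.
have CD0 : C + D != 0 by apply: lt0r_neq0; apply: addr_gt0.
have BE : B = C + D - A by rewrite -AB; ring.
have key (u v w z : R) : C * u + D * v = B * w + A * z ->
    (1 - t) * u + t * v = (1 - s) * w + s * z.
  move=> e; rewrite /s /t AB.
  transitivity ((C * u + D * v) / (C + D)); first by field.
  by rewrite e BE; field.
by congr pair; apply: key; rewrite /A /B /C /D /orient; ring.
Qed.
End ConvexPolygon.

Lemma crossesE (R : realType) n (p : 'I_n.+3 -> (R * R)%type) (a b c d : 'I_n.+3) :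
  convex_polygon p -> a != b -> c != d ->
  crosses p [set a; b]%SET [set c; d]%SET <-> chords_cross a b c d.
Proof.
by move=> hp ab cd; split; [exact: crosses_chords_cross|exact: chords_cross_crosses].
Qed.

Lemma ordSE n (a : 'I_n.+1) : ordS a = (if a == n :> nat then 0 else a.+1) :> nat.
Proof.
rewrite /=; case: eqP => [->|h]; first by rewrite modnn.
by rewrite modn_small // ltnS; have := ltn_ord a; lia.
Qed.

Lemma side_noncrossing n (x y a : 'I_n.+3) : chords_cross x y a (ordS a) = false.
Proof.
have := ltn_ord x; have := ltn_ord y; have := ltn_ord a; have := ordSE a.
move: (ordS a) => b; case: eqP => h1 h2; rewrite h2 /chords_cross /cyclic; lia.
Qed.

(** * Edges and triangles of a triangulation *)

Section DualPath.
Variables (R : realType) (n : nat) (p : 'I_n.+3 -> (R * R)%type).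
Hypothesis hp : convex_polygon p.
Variable T : {set {set 'I_n.+3}}.
Hypothesis triT : is_triangulation p T.
Implicit Types (a b c d x y z u v o : 'I_n.+3) (e t : {set 'I_n.+3}).
Local Open Scope set_scope.

Definition is_edge e := (is_side e \/ e \in T) /\ #|e| = 2.

Lemma edges_noncrossing a b c d : is_edge [set a; b] -> is_edge [set c; d] ->
  ~~ chords_cross a b c d.
Proof.
have side x y z u : is_side [set z; u] -> ~~ chords_cross x y z u.
  case/existsP => v /eqP/eq_set2[] [-> ->]; last rewrite chords_cross_flipr.
    by rewrite side_noncrossing.
  by rewrite side_noncrossing.
move=> [e1]; rewrite cards2 => -[/eqP]; rewrite eqb1 => ab.
move=> [e2]; rewrite cards2 => -[/eqP]; rewrite eqb1 => cd.
case: e2 => [/side//|e2]; case: e1 => [/side h|e1]; first by rewrite chords_crossC.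
apply/negP => /(crossesE hp ab cd); case: triT => _ _; exact.
Qed.

Lemma triangle_edge t u v : is_triangle T t -> u \in t -> v \in t -> u != v ->
  is_edge [set u; v].
Proof.
move=> [_ h] ut vt uv; split; last by rewrite cards2 uv.
apply: h; last by rewrite cards2 uv.
by apply/fintype.subsetP => z; rewrite !inE => /orP[]/eqP->.
Qed.

(** An edge cannot cut a triangle: a vertex u on the other side would make the edge zu cross xy. *)
Lemma triangle_weakly_left t x y z : is_triangle T t -> is_edge [set x; y] ->
  z \in t -> cyclic x y z -> forall u, u \in t -> weakly_left x y u.
Proof.
move=> tt exy zt xyz u ut; apply/negPn/negP; case/norP => ux /norP[uy uxy].
have zu : z != u by apply: contraNneq uxy => <-.
have := edges_noncrossing exy (triangle_edge tt zt ut zu).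
move: xyz ux uy uxy; rewrite /chords_cross /cyclic; lia.
Qed.

Lemma weakly_rightE (x y z : nat) : weakly_right x y z = weakly_left y x z.
Proof. by rewrite /weakly_right /weakly_left orbCA; congr [|| _, _ | _]; rewrite cyclic_rot cyclic_rot. Qed.

Lemma neighbour_apex t e : is_triangle T t -> e \subset t -> #|e| = 2 ->
  exists z, t = z |: e /\ z \notin e.
Proof.
move=> [t3 _] et e2; have : #|t :\: e| = 1 by rewrite cardsDS // t3 e2.
case/eqP/cards1P => z tz; exists z; split.
  by rewrite -(finset.setID t e) tz (finset.setIidPr et) finset.setUC.
have : z \in t :\: e by rewrite tz set11.
by rewrite inE => /andP[].
Qed.

(** If both apexes were on the same side of xy, then either ox would cross zy or oy would cross
    zx. *)
Lemma opposite_apexes t t' x y o z : is_triangle T t -> is_triangle T t' ->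
  t = o |: [set x; y] -> t' = z |: [set x; y] -> t != t' -> x != y ->
  cyclic x y o -> o \notin [set x; y] -> z \notin [set x; y] -> cyclic x z y.
Proof.
move=> tt tt' te te' ne xy xyo oxy; rewrite !inE negb_or => /andP[zx zy].
have zo : z != o by apply: contraNneq ne => e; rewrite te te' e.
move: oxy; rewrite !inE negb_or => /andP[ox oy].
have inx s w : s = w |: [set x; y] -> [/\ x \in s, y \in s & w \in s].
  by move=> ->; rewrite !inE !eqxx ?orbT.
have [xt yt ot] := inx _ _ te; have [xt' yt' zt'] := inx _ _ te'.
have ex u v : u != v -> v != u by rewrite eq_sym.
have h1 := edges_noncrossing (triangle_edge tt ot xt ox) (triangle_edge tt' zt' yt' zy).
have h2 := edges_noncrossing (triangle_edge tt ot yt oy) (triangle_edge tt' zt' xt' zx).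
move: h1 h2 zx zy xy zo xyo; rewrite -!val_eqE /chords_cross /cyclic /=; lia.
Qed.
End DualPath.

(** * The dual path *)

Lemma triangulation_inj (R : realType) n (p : 'I_n.+3 -> (R * R)%type)
    (delta : 'I_n -> {set 'I_n.+3}) :
  is_triangulation p [set delta i | i : 'I_n]%SET -> injective delta.
Proof.
move=> [_ cT _].
have /imset_injP inj : #|[set delta i | i : 'I_n]%SET| == #|'I_n| by rewrite cT card_ord.
by move=> i j; apply: inj.
Qed.

Section PathTriangulation.
Variables (R : realType) (n : nat) (p : 'I_n.+3 -> (R * R)%type).
Hypothesis hp : convex_polygon p.
Variables (c : n.-1.-tuple bool) (delta : 'I_n -> {set 'I_n.+3}).
Variable t : 'I_n.+1 -> {set 'I_n.+3}.
Let T := [set delta i | i : 'I_n]%SET.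
Hypothesis triT : is_triangulation p T.
Hypothesis pathT : is_dual_path T delta t.
Hypothesis turns : forall i j : 'I_n, j = i.+1 :> nat ->
  if nth false c i then turns_right p (delta i) (delta j)
  else turns_left p (delta i) (delta j).
Implicit Types (i j k : 'I_n) (x y z u v o : 'I_n.+3).
Local Open Scope set_scope.

Let delta_inj : injective delta. Proof. exact: triangulation_inj triT. Qed.

Let delta_edge i : is_edge T (delta i).
Proof.
have dT : delta i \in T by apply: imset_f.
by split; [right|have [/(_ _ dT)/andP[/eqP]] := triT].
Qed.

Let t_triangle (m : 'I_n.+1) : is_triangle T (t m).
Proof. by have [_ h _ _] := pathT; apply/h; exists m. Qed.

Let t_inj : injective t. Proof. by case: pathT. Qed.

Let delta_low i : delta i \subset t (ord_low i).
Proof. by have [_ _ _ ->] := pathT; apply: finset.subsetIl. Qed.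

Let delta_high i : delta i \subset t (ord_high i).
Proof. by have [_ _ _ ->] := pathT; apply: finset.subsetIr. Qed.

(* The vertices of t_k and t_(k+1), with delta_k = xy oriented as above. *)
Definition delta_frame k x y o z :=
  [/\ [/\ x != y, delta k = [set x; y],
      t (ord_low k) = o |: [set x; y] & t (ord_high k) = z |: [set x; y]],
      [/\ o \notin [set x; y] & z \notin [set x; y]],
      cyclic x y o & cyclic x z y].

(** The four vertices are packed into one tuple so that a single use of [choice] selects them for
    all k. *)
Lemma delta_frame_exists k : exists q, delta_frame k q.1.1 q.1.2 q.2.1 q.2.2.
Proof.
have [_ d2] := delta_edge k; have /cards2P[x [y [xy dxy]]] : #|delta k| == 2 by rewrite d2.
have [o [to oN]] := neighbour_apex (t_triangle _) (delta_low k) d2.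
have [z [tz zN]] := neighbour_apex (t_triangle _) (delta_high k) d2.
have lh : t (ord_low k) != t (ord_high k).
  by rewrite (inj_eq t_inj) -val_eqE /= /bump; lia.
rewrite dxy in to tz oN zN.
have opp := opposite_apexes hp triT (t_triangle _) (t_triangle _).
case: (boolP (cyclic x y o)) => [xyo|nxyo].
  exists ((x, y), (o, z)); split=> //=.
  exact: opp to tz lh xy xyo oN zN.
have yxo : cyclic y x o.
  move: nxyo oN xy; rewrite !inE negb_or -!val_eqE /cyclic /=; lia.
rewrite (finset.setUC [set x]) in dxy to tz oN zN; rewrite eq_sym in xy.
exists ((y, x), (o, z)); split=> //=.
exact: opp to tz lh xy yxo oN zN.
Qed.

(** Some end of delta_j is off delta_k, hence strictly left of it. It belongs to both triangles, and
    delta_k cuts neither. *)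
Let same_side k j x y : delta k = [set x; y] -> j != k ->
  forall m m' : 'I_n.+1, delta j \subset t m -> delta j \subset t m' ->
  (forall z, z \in t m -> weakly_left x y z) -> forall z, z \in t m' -> weakly_left x y z.
Proof.
move=> dk jk m m' jm jm' left.
have [z zj zk] : exists2 z, z \in delta j & z \notin delta k.
  apply/fintype.subsetPn; apply: contra jk => sub; apply/eqP/delta_inj/eqP.
  by rewrite eqEcard sub; have [_ ->] := delta_edge j; have [_ ->] := delta_edge k.
have zm' := fintype.subsetP jm' _ zj.
move: (left z (fintype.subsetP jm _ zj)) zk; rewrite dk !inE negb_or => /or3P[|| xyz].
- by rewrite val_eqE => ->.
- by rewrite val_eqE => -> /andP[].
move=> _; have exy : is_edge T [set x; y] by rewrite -dk.
exact: (triangle_weakly_left hp triT (t_triangle m') exy zm' xyz).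
Qed.

Let before_left k x y : delta k = [set x; y] ->
  (forall z, z \in t (ord_low k) -> weakly_left x y z) ->
  forall m : 'I_n.+1, m <= k -> forall z, z \in t m -> weakly_left x y z.
Proof.
move=> dk base m; have [d] := ubnP (k - m); elim: d m => // d IH m lt mk.
case: (ltnP m k) => [mk'|km]; last first.
  by have -> : m = ord_low k by apply: ord_inj => /=; lia.
have mn : m < n by rewrite (ltn_trans mk').
pose j := Ordinal mn.
have jk : j != k by rewrite -val_eqE /= ltn_eqF.
have -> : m = ord_low j by apply: ord_inj.
apply: (same_side dk jk (delta_high j) (delta_low j)).
by apply: IH; rewrite /= /bump; lia.
Qed.

Let after_left k x y : delta k = [set x; y] ->
  (forall z, z \in t (ord_high k) -> weakly_left x y z) ->
  forall m : 'I_n.+1, k < m -> forall z, z \in t m -> weakly_left x y z.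
Proof.
move=> dk base [m hm]; elim: m hm => // m IH hm; rewrite /= ltnS leq_eqVlt => /orP[/eqP km|km].
  by have -> : Ordinal hm = ord_high k by apply: ord_inj; rewrite /= /bump km.
have mn : m < n by [].
pose j := Ordinal mn.
have jk : j != k by rewrite -val_eqE /= gtn_eqF.
have -> : Ordinal hm = ord_high j by apply: ord_inj.
apply: (same_side dk jk (delta_low j) (delta_high j)).
have -> : ord_low j = Ordinal (ltnW hm) by apply: ord_inj.
exact: IH.
Qed.

Lemma frame_left k x y o z : delta_frame k x y o z ->
  forall m : 'I_n.+1, m <= k -> forall u, u \in t m -> weakly_left x y u.
Proof.
move=> [[_ dk tl _] _ xyo _]; apply: before_left => // u.
rewrite tl !inE /weakly_left => /or3P[] /eqP->; rewrite ?eqxx ?orbT //.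
by rewrite xyo !orbT.
Qed.

Lemma frame_right k x y o z : delta_frame k x y o z ->
  forall m : 'I_n.+1, k < m -> forall u, u \in t m -> weakly_right x y u.
Proof.
move=> [[_ dk _ th] _ _ xzy] m km u um; rewrite weakly_rightE.
apply: (@after_left k) um => //; first by rewrite dk finset.setUC.
move=> v; rewrite th !inE /weakly_left => /or3P[] /eqP->; rewrite ?eqxx ?orbT //.
by rewrite 2!cyclic_rot in xzy *; rewrite xzy !orbT.
Qed.

Let frame_mem k x y o z : delta_frame k x y o z ->
  [/\ o \in t (ord_low k), z \in t (ord_high k) & forall u, u \in delta k -> u = x \/ u = y].
Proof.
move=> [[_ dk -> ->] _ _ _]; split; rewrite ?setU11 // => u.
by rewrite dk !inE => /orP[]/eqP; auto.
Qed.

Let low_ne_high (x y u : nat) : cyclic x y u -> weakly_right x y u -> False.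
Proof. rewrite /weakly_right /cyclic; lia. Qed.

Let high_ne_low (x y u : nat) : cyclic x u y -> weakly_left x y u -> False.
Proof. rewrite /weakly_left /cyclic; lia. Qed.

(** What has to be added to [frame_left] is strictness. An end of delta_k lies in t_(k+1), hence
    weakly right of delta_i, whereas o' is strictly left of delta_i. *)
Lemma frame_out_left k i x y o z x' y' o' z' : delta_frame k x y o z ->
  delta_frame i x' y' o' z' -> i <= k -> cyclic x y o'.
Proof.
move=> fk fi ik; have [ot _ _] := frame_mem fi.
have not_in : o' \notin delta k.
  apply/negP => odk; have [_ _ xyo _] := fi.
  apply: low_ne_high xyo _; apply: (frame_right fi) (fintype.subsetP (delta_high k) _ odk).
  by rewrite /= /bump; lia.
have := frame_left fk (m := ord_low i) ik ot.
have [[_ dk _ _] _ _ _] := fk.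
by move: not_in; rewrite dk !inE negb_or -!val_eqE /weakly_left => /andP[/negPf -> /negPf ->].
Qed.

Lemma frame_in_right k j x y o z x' y' o' z' : delta_frame k x y o z ->
  delta_frame j x' y' o' z' -> k <= j -> cyclic x z' y.
Proof.
move=> fk fj kj; have [_ zt _] := frame_mem fj.
have not_in : z' \notin delta k.
  apply/negP => zdk; have [_ _ _ xzy] := fj.
  by apply: high_ne_low xzy _; apply: (frame_left fj) (fintype.subsetP (delta_low k) _ zdk).
have kj' : k < ord_high j by rewrite /= /bump; lia.
have := frame_right fk kj' zt.
have [[_ dk _ _] _ _ _] := fk.
by move: not_in; rewrite dk !inE negb_or -!val_eqE /weakly_right => /andP[/negPf -> /negPf ->].
Qed.

(** Both frames see the triangle aqr = t_(i+1), with a = o' and r = z. The pivot q is the shared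
    first end of delta_i and delta_j at a right turn, the shared second end at a left turn. *)
Lemma frame_step i j x y o z x' y' o' z' : j = i.+1 :> nat ->
  delta_frame i x y o z -> delta_frame j x' y' o' z' ->
  if nth false c i then [/\ x' = x, o' = y & z = y'] else [/\ y' = y, o' = x & z = x'].
Proof.
move=> ij fi fj; have := turns ij.
have tij : t (ord_high i) = t (ord_low j).
  by congr t; apply: ord_inj; rewrite /= /bump ij.
have [[_ di _ ti] [_ zi] _ xzy] := fi; have [[_ dj tj _] [oj _] xyo _] := fj.
have main (a q r : 'I_n.+3) : delta i = [set a; q] -> delta j = [set q; r] ->
    a != r -> a != q -> q != r -> a = o' /\ z = r.
  move=> di' dj' ar aq qr.
  have: a \in t (ord_low j) by rewrite -tij ti -di di' !inE eqxx orbT.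
  have: r \in t (ord_high i) by rewrite tij tj -dj dj' !inE eqxx !orbT.
  rewrite ti tj -di di' -dj dj' !inE (negPf aq) (negPf ar) ![r == _]eq_sym (negPf ar) (negPf qr).
  by rewrite !orbF => /eqP -> /eqP.
have frames (a q r : 'I_n.+3) : delta i = [set a; q] -> delta j = [set q; r] ->
    cyclic a q r \/ cyclic a r q ->
    [/\ o' = a, z = r, (x = a /\ y = q) \/ (x = q /\ y = a) &
        (x' = q /\ y' = r) \/ (x' = r /\ y' = q)].
  move=> di' dj' aqr; have [||| <- ->] := main a q r di' dj'.
  - by apply/eqP => e; case: aqr; rewrite e /cyclic; lia.
  - by apply/eqP => e; case: aqr; rewrite e /cyclic; lia.
  - by apply/eqP => e; case: aqr; rewrite e /cyclic; lia.
  by split=> //; [apply: eq_set2; rewrite -di|apply: eq_set2; rewrite -dj].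
case: ifP => _ [a [q [r [di' dj']]]]; rewrite ?orient_pos ?orient_neg // => aqr.
  have [eo ez Ex Ey] := frames a q r di' dj' (or_introl aqr).
  case: Ex Ey => -[ex ey] [] [ex' ey']; move: aqr xyo xzy;
    rewrite eo ez ex ey ex' ey' => h1 h2 h3; try (by split);
    by exfalso; move: h1 h2 h3; rewrite /cyclic; lia.
have [eo ez Ex Ey] := frames a q r di' dj' (or_intror aqr).
case: Ex Ey => -[ex ey] [] [ex' ey']; move: aqr xyo xzy;
  rewrite eo ez ex ey ex' ey' => h1 h2 h3; try (by split);
  by exfalso; move: h1 h2 h3; rewrite /cyclic; lia.
Qed.

Hypothesis n_gt0 : 0 < n.

Lemma zigzag_exists : exists X Y O I : nat -> 'I_n.+3,
  forall k, delta_frame k (X k) (Y k) (O k) (I k.+1).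
Proof.
have [f hf] := choice delta_frame_exists.
(* Indices from n on receive the frame of delta_0 as a default. The predecessor in the last witness
   is there because the vertex beyond delta_k belongs to t_(k+1). *)
pose g (m : nat) := f (insubd (Ordinal n_gt0) m).
exists (fun m => (g m).1.1), (fun m => (g m).1.2), (fun m => (g m).2.1),
  (fun m => (g m.-1).2.2) => k /=.
have -> : g k = f k by rewrite /g valKd.
exact: hf.
Qed.
End PathTriangulation.

(** * Maximal noncrossing sets *)

Section Apex.
Variable n : nat.
Local Notation V := 'I_n.+3.
Implicit Types (a b m u v : V) (q r : V * V).
Local Open Scope set_scope.

Definition ordered_diagonal (a b : nat) : bool :=
  (a.+1 < b) && ~~ ((a == 0) && (b == n.+2)).

Variable F : {set V * V}.
Hypothesis diagF : forall a b, (a, b) \in F -> ordered_diagonal a b.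
Hypothesis noncrossF : forall q r, q \in F -> r \in F -> ~~ chords_cross q.1 q.2 r.1 r.2.

(** The closing side also has a triangle below it; with it, the expected number of chords is n + 1,
    the number of vertices other than 0 and n + 2. *)
Let G : {set V * V} := (ord0, ord_max) |: F.

(* If [F] is maximal, m is the third vertex of the triangle below the chord q. *)
Definition is_apex (q : V * V) (m : V) : Prop :=
  [/\ q.1 < m < q.2, (m == q.1.+1 :> nat) || ((q.1, m) \in F) &
      forall m' : V, m < m' < q.2 -> (q.1, m') \notin F].

Let G_cases q : q \in G ->
  (q.1 = 0 :> nat /\ q.2 = n.+2 :> nat) \/ (q \in F /\ ordered_diagonal q.1 q.2).
Proof.
rewrite !inE => /orP[/eqP ->|qF]; first by left.
by right; split=> //; apply: diagF; rewrite -surjective_pairing.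
Qed.

Let G_width q : q \in G -> q.1.+1 < q.2.
Proof. by case/G_cases => [[-> ->]|[_ /andP[]]]. Qed.

Lemma apex_exists q : q \in G -> exists m, is_apex q m.
Proof.
move=> qG; have w := G_width qG.
pose P (m : V) := (q.1 < m < q.2) && ((m == q.1.+1 :> nat) || ((q.1, m) \in F)).
have h : q.1.+1 < n.+3 by apply: ltn_trans w _.
have P0 : P (Ordinal h) by rewrite /P /= ltnSn w eqxx.
case: (@arg_maxnP _ (Ordinal h) P (fun m : V => m : nat) P0) => m /andP[m1 m2] mx.
exists m; split=> // m' /andP[mm' m'q]; apply/negP => qm'.
have := mx m'; rewrite /P m'q qm' orbT !andbT => /(_ _); lia.
Qed.

Lemma apex_uniq q m m' : is_apex q m -> is_apex q m' -> m = m'.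
Proof.
wlog lt : m m' / m < m' => [W h h'|[h1 _ h3] [h1' h2' _]].
  have [lt|lt|/ord_inj //] := ltngtP m m'; first exact: W.
  by apply/esym; apply: W.
case/orP: h2' => [/eqP|h]; first lia.
by have /negP[] : (q.1, m') \notin F by apply: h3; rewrite lt; case/andP: h1'.
Qed.

(** If q starts before r, the chord from [q.1] to m is in [F] and crosses r. If they start together
    and r is shorter, r itself contradicts the choice of m as the farthest neighbour below q. *)
Lemma apex_inj q r m : q \in G -> r \in G -> is_apex q m -> is_apex r m -> q = r.
Proof.
wlog le : q r / q.1 < r.1 \/ (q.1 = r.1 :> nat /\ r.2 <= q.2).
  move=> W qG rG qm rm.
  have [h|h|h] := ltngtP q.1 r.1; [by apply: W => //; left|by apply/esym; apply: W => //; left|].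
  have [h'|h'] := leqP r.2 q.2; first by apply: (W q r) => //; right; split.
  by apply/esym; apply: (W r q) => //; right; split=> //; apply: ltnW.
move=> qG rG [q1 q2 q3] [r1 r2 r3].
case: (G_cases rG) => [[r0 rn]|[rF _]].
  case: le => [|[e le]]; first by rewrite r0.
  rewrite [q]surjective_pairing [r]surjective_pairing (ord_inj e); congr pair.
  by apply: ord_inj; have := ltn_ord q.2; lia.
case: le => [lt|[e le]].
  case/orP: q2 => [/eqP q2|q2]; first by lia.
  by have := noncrossF q2 rF; rewrite /chords_cross /cyclic /=; lia.
rewrite [q]surjective_pairing [r]surjective_pairing (ord_inj e); congr pair.
apply: ord_inj; apply/eqP; rewrite eqn_leq le andbT leqNgt; apply/negP => lt.
have : (q.1, r.2) \notin F by apply: q3; rewrite lt andbT; case/andP: r1.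
by rewrite (ord_inj e) -surjective_pairing rF.
Qed.

Let interior : {set V} := [set m : V | 0 < m < n.+2].

Let card_interior : #|interior| = n.+1.
Proof.
have -> : interior = ~: [set ord0; ord_max].
  by apply/setP => m; rewrite !inE -!val_eqE /=; have := ltn_ord m; lia.
by rewrite cardsCs finset.setCK cards2 card_ord.
Qed.

Let root_notin : (ord0, ord_max) \notin F.
Proof. by apply/negP => /diagF /andP[_]; rewrite !eqxx. Qed.

Let apex_fun : exists f : V * V -> V, forall q, q \in G -> is_apex q (f q).
Proof.
have h q : exists m, q \in G -> is_apex q m.
  case: (boolP (q \in G)) => [/apex_exists[m hm]|_]; first by exists m.
  by exists ord0.
by have [f hf] := choice h; exists f.
Qed.

Let apex_interior q m : is_apex q m -> m \in interior.
Proof. by case=> h _ _; rewrite inE; have := ltn_ord q.2; lia. Qed.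

(* Sending a chord to the apex of the triangle below it is injective. *)
Lemma noncrossing_card_le : #|F| <= n.
Proof.
have [f hf] := apex_fun.
have injf : {in G &, injective f}.
  by move=> q r qG rG e; apply: (apex_inj qG rG (hf _ qG)); rewrite e; apply: hf.
have : #|G| <= n.+1.
  apply: (leq_trans _ (eq_leq card_interior)).
  rewrite -(card_in_imset injf); apply/subset_leq_card/fintype.subsetP.
  by move=> _ /imsetP[q qG ->]; apply/apex_interior/hf.
by rewrite /G cardsU1 root_notin.
Qed.

Hypothesis maxF : forall a b, ordered_diagonal a b ->
  (forall q, q \in F -> ~~ chords_cross a b q.1 q.2) -> (a, b) \in F.

Let apex_surj m : m \in interior -> exists2 q, q \in G & is_apex q m.
Proof.
rewrite inE => /andP[m0 mn].
pose P (q : V * V) := (q \in G) && (q.1 < m < q.2).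
have P0 : P (ord0, ord_max) by rewrite /P /G setU11 /= m0.
(* Take a shortest chord q passing over m. A chord crossing the one from [q.1] to m, but not q,
   would be a shorter chord over m; so would a chord from [q.1] to some m' between m and [q.2]. *)
have [q [qG qm minq]] : exists q : V * V, [/\ q \in G, q.1 < m < q.2 &
    forall r : V * V, P r -> q.2 - q.1 <= r.2 - r.1].
  by case: (@arg_minnP _ _ P (fun q => q.2 - q.1) P0) => q /andP[qG qm] minq; exists q.
exists q => //; split=> // [|m' m'q].
  have [|ne] := eqVneq (m : nat) q.1.+1; first by [].
  apply: maxF => [|r rF]; first by rewrite /ordered_diagonal; lia.
  have rG : r \in G by rewrite inE rF orbT.
  have qr : ~~ chords_cross q.1 q.2 r.1 r.2.
    case: (G_cases qG) => [[-> ->]|[qF _]]; last exact: noncrossF.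
    have := ltn_ord r.1; have := ltn_ord r.2; rewrite /chords_cross /cyclic; lia.
  have := minq r; rewrite /P rG /= => min.
  have w := G_width rG.
  apply/negP => cr.
  have rm : r.1 < m < r.2 by move: qr cr w qm; rewrite /chords_cross /cyclic; lia.
  have := min rm; move: qr cr w qm rm; rewrite /chords_cross /cyclic; lia.
apply/negP => qm'; have qG' : (q.1, m') \in G by rewrite inE qm' orbT.
have := minq (q.1, m'); rewrite /P qG' /=; lia.
Qed.

Lemma maximal_noncrossing_card : #|F| = n.
Proof.
apply/eqP; rewrite eqn_leq noncrossing_card_le /=.
have [f hf] := apex_fun.
have : #|interior| <= #|G|.
  apply: leq_trans (leq_imset_card f G); apply/subset_leq_card/fintype.subsetP => m mi.
  have [q qG qm] := apex_surj mi; apply/imsetP; exists q => //.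
  exact: apex_uniq qm (hf _ qG).
by rewrite card_interior /G cardsU1 root_notin.
Qed.
End Apex.

(** * Cardinality of noncrossing sets of diagonals *)

Section SetsOfDiagonals.
Variables (R : realType) (n : nat) (p : 'I_n.+3 -> (R * R)%type).
Hypothesis hp : convex_polygon p.
Local Notation V := 'I_n.+3.
Implicit Types (a b : V) (d e : {set V}) (T : {set {set V}}).
Local Open Scope set_scope.

Lemma sideP d : reflect (exists a, d = [set a; ordS a]) (is_side d).
Proof. by apply: (iffP existsP) => -[a h]; exists a; apply/eqP. Qed.

Lemma is_side_lt a b : a < b -> is_side [set a; b] = ~~ ordered_diagonal n a b.
Proof.
move=> ab; rewrite /ordered_diagonal; apply/idP/idP.
  case/sideP => x /eq_set2[] [ea eb]; move: ab (ordSE x) (ltn_ord x);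
    rewrite ea eb; move: (ordS x) => y; case: eqP; lia.
rewrite negb_and negbK => h; apply/sideP.
case: (ltnP a.+1 b) h => [_ /= /andP[/eqP a0 /eqP bn]|h _].
  exists b; rewrite finset.setUC; congr [set _; _]; apply: ord_inj.
  by rewrite ordSE bn eqxx.
exists a; congr [set _; _]; apply: ord_inj.
by rewrite ordSE; have := ltn_ord b; case: eqP; lia.
Qed.

Lemma is_diagonal_lt a b : a < b -> is_diagonal [set a; b] = ordered_diagonal n a b.
Proof. by move=> ab; rewrite /is_diagonal cards2 is_side_lt // negbK -val_eqE neq_ltn ab. Qed.

Lemma diagonal_ends d : is_diagonal d -> exists a b, a < b /\ d = [set a; b].
Proof.
case/andP => /cards2P[a [b [ab ->]]] _; have [h|h|/ord_inj h] := ltngtP a b.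
- by exists a, b.
- by exists b, a; rewrite finset.setUC.
- by rewrite h eqxx in ab.
Qed.

Definition ordered_pairs T := [set q : V * V | (q.1 < q.2) && ([set q.1; q.2] \in T)].

Variable T : {set {set V}}.
Hypothesis diagT : forall d, d \in T -> is_diagonal d.
Hypothesis noncrossT : forall d e, d \in T -> e \in T -> ~ crosses p d e.

Let card_ordered_pairs : #|ordered_pairs T| = #|T|.
Proof.
rewrite -(@card_in_imset _ _ (fun q : V * V => [set q.1; q.2])).
  apply: eq_card => d; apply/imsetP/idP => [[q]|dT]; first by rewrite inE => /andP[_ h] ->.
  have [a [b [ab e]]] := diagonal_ends (diagT dT).
  by exists (a, b); rewrite ?inE /= ?ab -?e.
move=> [a b] [k l]; rewrite !inE /= => /andP[ab _] /andP[kl _] /eq_set2[] [ea eb].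
  by rewrite ea eb.
by move: ab kl; rewrite ea eb; lia.
Qed.

Let diag_pairs a b : (a, b) \in ordered_pairs T -> ordered_diagonal n a b.
Proof. by rewrite inE /= => /andP[ab /diagT]; rewrite is_diagonal_lt. Qed.

Let ne_lt a b : a < b -> a != b. Proof. by move=> ab; rewrite -val_eqE neq_ltn ab. Qed.

Let noncross_pairs (q r : V * V) : q \in ordered_pairs T -> r \in ordered_pairs T ->
  ~~ chords_cross q.1 q.2 r.1 r.2.
Proof.
rewrite !inE => /andP[hq qT] /andP[hr rT].
by apply/negP => /(crossesE hp (ne_lt hq) (ne_lt hr)); apply: noncrossT.
Qed.

Lemma noncrossing_diagonals_card_le : #|T| <= n.
Proof. by rewrite -card_ordered_pairs; apply: noncrossing_card_le. Qed.

Lemma maximal_noncrossing_diagonals_card :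
  (forall d, is_diagonal d -> (forall e, e \in T -> ~ crosses p d e) -> d \in T) ->
  #|T| = n.
Proof.
move=> maxT; rewrite -card_ordered_pairs; apply: maximal_noncrossing_card => // a b ab h.
have lt : a < b by case/andP: ab; lia.
rewrite inE /= lt; apply: maxT => [|e eT]; first by rewrite is_diagonal_lt.
have [k [l [kl ee]]] := diagonal_ends (diagT eT); rewrite ee.
move/(crossesE hp (ne_lt lt) (ne_lt kl)); apply/negP.
by apply: (h (k, l)); rewrite inE /= kl -ee.
Qed.
End SetsOfDiagonals.

(** * Counting diagonals and almost positive roots *)

Lemma card_increasing_pairs m : #|[set q : 'I_m * 'I_m | q.1 < q.2]%SET| = 'C(m, 2).
Proof.
have <- : #|[set A : {set 'I_m} | #|A| == 2]%SET| = 'C(m, 2) by rewrite card_draws card_ord.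
rewrite -(@card_in_imset _ _ (fun q : 'I_m * 'I_m => [set q.1; q.2]%SET)).
  apply: eq_card => A; rewrite inE; apply/imsetP/idP => [[q]|].
    by rewrite inE => h ->; rewrite cards2 -val_eqE neq_ltn h.
  case/cards2P => a [b [ab ->]]; have [h|h|/ord_inj h] := ltngtP a b.
  - by exists (a, b); rewrite ?inE.
  - by exists (b, a); rewrite ?inE // finset.setUC.
  - by rewrite h eqxx in ab.
move=> [a b] [k l]; rewrite !inE /= => ab kl /eq_set2[] [ea eb].
  by rewrite ea eb.
by move: ab kl; rewrite ea eb; lia.
Qed.

(** All pairs of vertices except the n + 3 sides; the value is written in the form in which almost
    positive roots are counted, positive roots plus negative simple ones. *)
Lemma card_diagonals n : #|[set d : {set 'I_n.+3} | is_diagonal d]%SET| = 'C(n.+1, 2) + n.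
Proof.
pose S := [set [set a; ordS a]%SET | a : 'I_n.+3]%SET.
pose D := [set d : {set 'I_n.+3} | is_diagonal d]%SET.
have cS : #|S| = n.+3.
  rewrite card_imset ?card_ord // => a b /eq_set2[] [ea eb] //.
  move: (ordSE a) (ordSE b) (ltn_ord b); rewrite eb -ea.
  by do 2?case: eqP; lia.
have : #|[set A : {set 'I_n.+3} | #|A| == 2]%SET| = 'C(n.+3, 2) by rewrite card_draws card_ord.
have -> : [set A : {set 'I_n.+3} | #|A| == 2]%SET = (D :|: S)%SET.
  apply/setP => d; rewrite !inE /is_diagonal.
  have -> : (d \in S) = is_side d.
    by apply/imsetP/sideP => [[a _ ->]|[a ->]]; exists a.
  case: (boolP (is_side d)) => [/sideP[a ->]|_]; rewrite ?orbT ?orbF ?andbT //.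
  have h : a != ordS a by apply/eqP => /(congr1 (@nat_of_ord _)); rewrite ordSE; case: eqP; lia.
  by rewrite cards2 h.
rewrite cardsU cS (_ : D :&: S = finset.set0)%SET ?cards0 ?subn0; last first.
  apply/setP => d; rewrite !inE; apply/negP => /andP[/andP[_ /negP h]] /imsetP[a _ e].
  by apply: h; apply/sideP; exists a.
rewrite !binS !bin1 !bin0 -/D; lia.
Qed.

Lemma card_almost_positive n :
  #|[set q : 'I_n.+1 * 'I_n.+1 | almost_positive q.1 q.2]%SET| = 'C(n.+1, 2) + n.
Proof.
pose N := [set (ord_high i, ord_low i) | i : 'I_n]%SET.
have -> : [set q : 'I_n.+1 * 'I_n.+1 | almost_positive q.1 q.2]%SET =
    ([set q : 'I_n.+1 * 'I_n.+1 | q.1 < q.2] :|: N)%SET.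
  apply/setP => -[a b]; rewrite !inE /almost_positive /=; congr (_ || _).
  apply/eqP/imsetP => [h|[i _ [-> ->]]]; last by rewrite ord_highE.
  by have [i [-> ->]] := negative_index h; exists i.
rewrite cardsU card_increasing_pairs (_ : _ :&: N = finset.set0)%SET ?cards0 ?subn0.
  by rewrite card_imset ?card_ord // => i j [_ e]; apply: ord_inj.
apply/setP => q; rewrite !inE; apply/negP => /andP[h] /imsetP[i _ e].
by move: h; rewrite e /= /bump; lia.
Qed.

(** * Diagonals and roots *)

Section RootsOfDiagonals.
Variables (R : realType) (n : nat) (p : 'I_n.+3 -> (R * R)%type).
Hypothesis hp : convex_polygon p.
Variables (c : n.-1.-tuple bool) (delta : 'I_n -> {set 'I_n.+3}).
Variable t : 'I_n.+1 -> {set 'I_n.+3}.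
Let T := [set delta i | i : 'I_n]%SET.
Hypothesis triT : is_triangulation p T.
Hypothesis pathT : is_dual_path T delta t.
Hypothesis turns : forall i j : 'I_n, j = i.+1 :> nat ->
  if nth false c i then turns_right p (delta i) (delta j)
  else turns_left p (delta i) (delta j).
Variable eps : nat -> bool.
(** [c] starts at the first inner triangle t_1, while [eps] is indexed by the triangles themselves,
    hence the shift. *)
Hypothesis epsE : forall i j : 'I_n, j = i.+1 :> nat -> eps j = nth false c i.
Variables X Y O I : nat -> 'I_n.+3.
Hypothesis frame : forall k : 'I_n, delta_frame delta t k (X k) (Y k) (O k) (I k.+1).
Implicit Types (a b k l : 'I_n.+1) (i j : 'I_n).

Let out_left (i k : nat) : i <= k < n -> cyclic (X k) (Y k) (O i).
Proof.
move=> /andP[ik kn]; have hi := leq_ltn_trans ik kn.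
exact: (frame_out_left hp triT pathT (frame (Ordinal kn)) (frame (Ordinal hi))).
Qed.

Let in_right (k j : nat) : k < j <= n -> cyclic (X k) (I j) (Y k).
Proof.
case: j => [|j]; first by rewrite ltn0.
move=> /andP[kj jn]; have kn : k < n by apply: leq_trans kj jn.
exact: (frame_in_right hp triT pathT (frame (Ordinal kn)) (frame (Ordinal jn))).
Qed.

Let out_right (k i : nat) : k < i < n -> weakly_right (X k) (Y k) (O i).
Proof.
move=> /andP[ki hi]; have kn := ltn_trans ki hi.
apply: (frame_right hp triT pathT (frame (Ordinal kn)) (m := ord_low (Ordinal hi))) => //.
by have [[_ _ -> _] _ _ _] := frame (Ordinal hi); rewrite setU11.
Qed.

Let in_left (j k : nat) : 0 < j <= k -> k < n -> weakly_left (X k) (Y k) (I j).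
Proof.
case: j => // j /andP[_ jk] kn; have jn := ltn_trans jk kn.
apply: (frame_left hp triT pathT (frame (Ordinal kn)) (m := ord_high (Ordinal jn))).
  by rewrite ord_highE.
by have [[_ _ _ ->] _ _ _] := frame (Ordinal jn); rewrite setU11.
Qed.

Let stepE (k : nat) : 0 < k < n ->
  if eps k then [/\ X k = X k.-1 :> nat, O k = Y k.-1 :> nat & I k = Y k :> nat]
  else [/\ Y k = Y k.-1 :> nat, O k = X k.-1 :> nat & I k = X k :> nat].
Proof.
case: k => // k /= kn; have kn' := ltnW kn.
have e : Ordinal kn = (Ordinal kn').+1 :> nat by [].
have := frame_step hp turns e (frame (Ordinal kn')) (frame (Ordinal kn)).
by rewrite -(epsE e) /=; case: (eps _) => -[-> -> ->].
Qed.

(** The inverse of [diagonal_vector] on almost positive roots; the second branch is delta_b. *)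
Definition diagonal_of_root a b : {set 'I_n.+3} :=
  if a < b then [set O a; I b]%SET else [set X b; Y b]%SET.

Let deltaE i : delta i = [set X i; Y i]%SET.
Proof. by have [[]] := frame i. Qed.

Let XY_neq i : X i != Y i.
Proof. by have [[]] := frame i. Qed.

Let diagonal_of_pos a b : a < b -> diagonal_of_root a b = [set O a; I b]%SET.
Proof. by rewrite /diagonal_of_root => ->. Qed.

Let diagonal_of_neg i : diagonal_of_root (ord_high i) (ord_low i) = delta i.
Proof. by rewrite /diagonal_of_root ifF ?deltaE // ord_highE /=; lia. Qed.

Let chord_cross_delta a b i : a < b ->
  chords_cross (O a) (I b) (X i) (Y i) = (a <= i < b).
Proof.
move=> ab; apply: (cross_delta (n := n) (X := X) (Y := Y) (O := O) (I := I)) => //.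
by rewrite ab -ltnS ltn_ord.
Qed.

Let OI_neq a b : a < b -> O a != I b.
Proof.
move=> ab; have an : a < n by have := ltn_ord b; lia.
(* A chord reduced to a point crosses nothing, whereas this one crosses delta_a. *)
apply/eqP => e; have := chord_cross_delta (Ordinal an) ab.
by rewrite e leqnn ab /chords_cross /cyclic /=; lia.
Qed.

Let T_noncrossing i j : ~ crosses p (delta i) (delta j).
Proof. by have [_ _] := triT; apply; apply: imset_f. Qed.

Lemma crosses_diagonal_of_root a b k l : almost_positive a b -> almost_positive k l ->
  crosses p (diagonal_of_root a b) (diagonal_of_root k l) <->
  ~~ roots_compatible eps a b k l.
Proof.
have neg_pos i a' b' : a' < b' ->
    crosses p (delta i) [set O a'; I b']%SET <-> ~~ roots_compatible eps i.+1 i a' b'.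
  move=> ab; rewrite deltaE (crossesE hp (XY_neq i) (OI_neq ab)) chords_crossC.
  by rewrite (chord_cross_delta i ab) roots_compatible_neg // negbK.
have neg a' b' : almost_positive a' b' -> ~~ (a' < b') ->
    exists i, a' = ord_high i /\ b' = ord_low i.
  by rewrite /almost_positive => /orP[->//|/eqP/negative_index].
have crossC (d e : {set 'I_n.+3}) : crosses p d e <-> crosses p e d.
  by split=> -[h [x [h1 h2]]]; (split; [exact: nesym|exists x]).
move=> vab vkl.
case: (boolP (a < b)) => ab; case: (boolP (k < l)) => kl.
- rewrite !diagonal_of_pos // (crossesE hp (OI_neq ab) (OI_neq kl)).
  rewrite (cross_in_out (n := n) (eps := eps) (X := X) (Y := Y) (O := O) (I := I)) //.
  + by rewrite ab -ltnS ltn_ord.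
  + by rewrite kl -ltnS ltn_ord.
- have [i [-> ->]] := neg _ _ vkl kl; rewrite diagonal_of_neg diagonal_of_pos //.
  by rewrite crossC neg_pos // roots_compatible_sym ord_highE.
- have [i [-> ->]] := neg _ _ vab ab; rewrite diagonal_of_neg diagonal_of_pos //.
  by rewrite neg_pos // ord_highE.
- have [i [-> ->]] := neg _ _ vab ab; have [j [-> ->]] := neg _ _ vkl kl.
  rewrite !diagonal_of_neg /roots_compatible !ord_highE !ltnSn /=.
  by split=> // /T_noncrossing.
Qed.

Let pos_not_delta a b i : a < b -> diagonal_of_root a b != delta i.
Proof.
move=> ab; have an : a < n by have := ltn_ord b; lia.
apply/eqP => e; apply: (@T_noncrossing i (Ordinal an)); rewrite -e diagonal_of_pos // deltaE.
by apply/(crossesE hp (OI_neq ab) (XY_neq _)); rewrite chord_cross_delta // leqnn.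
Qed.

Let delta_inj : injective delta. Proof. exact: triangulation_inj triT. Qed.

Lemma diagonal_vector_of_root a b : almost_positive a b ->
  diagonal_vector p delta (diagonal_of_root a b) = rootv R a b.
Proof.
rewrite /almost_positive => /orP[ab|/eqP/negative_index[i [-> ->]]]; last first.
  rewrite diagonal_of_neg /diagonal_vector; case: pickP => [j /eqP/delta_inj <-|/(_ i)].
    by rewrite opp_simple_root.
  by rewrite eqxx.
rewrite /diagonal_vector; case: pickP => [j|_].
  by rewrite (negPf (pos_not_delta j ab)).
rewrite -sum_simple_roots_interval; last exact: ltnW.
apply: eq_bigl => i; rewrite diagonal_of_pos // deltaE -chord_cross_delta //.
by apply/asboolP/idP => /(crossesE hp (OI_neq ab) (XY_neq i)).
Qed.

Lemma is_diagonal_of_root a b : almost_positive a b -> is_diagonal (diagonal_of_root a b).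
Proof.
rewrite /almost_positive => /orP[ab|/eqP/negative_index[i [-> ->]]]; last first.
  by rewrite diagonal_of_neg; have [h _ _] := triT; apply: h; apply: imset_f.
rewrite diagonal_of_pos // /is_diagonal cards2 OI_neq //=.
have an : a < n by have := ltn_ord b; lia.
apply/sideP => -[x /eq_set2 e].
have := chord_cross_delta (Ordinal an) ab; rewrite leqnn ab chords_crossC.
case: e => -[-> ->]; last rewrite chords_cross_flipr.
  by rewrite side_noncrossing.
by rewrite side_noncrossing.
Qed.

(** The map is injective because [diagonal_vector] recovers the root, and there are as many almost
    positive roots as diagonals. *)
Lemma diagonal_of_root_surj d : is_diagonal d ->
  exists a b, almost_positive a b /\ d = diagonal_of_root a b.
Proof.
move=> dd.
pose C := [set q : 'I_n.+1 * 'I_n.+1 | almost_positive q.1 q.2]%SET.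
pose D := [set d : {set 'I_n.+3} | is_diagonal d]%SET.
pose f (q : 'I_n.+1 * 'I_n.+1) := diagonal_of_root q.1 q.2.
have inj : {in C &, injective f}.
  move=> [a b] [k l]; rewrite !inE /= => vab vkl.
  move/(congr1 (diagonal_vector p delta)); rewrite /f /= !diagonal_vector_of_root //.
  by case/(root_inj (almost_positive_neq vab)) => -> ->.
have : (f @: C)%SET == D.
  rewrite eqEcard; apply/andP; split.
    by apply/fintype.subsetP => _ /imsetP[[a b] h ->]; rewrite !inE in h *; apply: is_diagonal_of_root.
  by rewrite card_in_imset // card_diagonals card_almost_positive.
move=> /eqP e; have : d \in D by rewrite inE.
by rewrite -e => /imsetP[[a b]]; rewrite inE => vab ->; exists a, b.
Qed.
End RootsOfDiagonals.

(** * Clusters as images of triangulations *)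

Section ClustersOfTriangulations.
Variables (R : realType) (n : nat) (p : 'I_n.+3 -> (R * R)%type).
Hypothesis hp : convex_polygon p.
Variables (v : {set 'I_n.+3} -> 'rV[R]_n.+1) (g : 'S_n.+1).
Hypothesis v_root : forall d, is_diagonal d -> almost_positive_root (v d).
Hypothesis v_inj : forall d e, is_diagonal d -> is_diagonal e -> v d = v e -> d = e.
Hypothesis v_surj : forall b, almost_positive_root b -> exists2 d, is_diagonal d & b = v d.
Hypothesis v_compat : forall d e, is_diagonal d -> is_diagonal e -> d <> e ->
  (c_compatible g (v d) (v e) <-> ~ crosses p d e).
Implicit Types (T : {set {set 'I_n.+3}}) (S : set 'rV[R]_n.+1).
Local Open Scope classical_set_scope.

Let rays T : set 'rV[R]_n.+1 := [set b | exists2 d, d \in T & b = v d].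

(** A further compatible root would come from a diagonal crossing none of [T], giving n + 1
    noncrossing diagonals. *)
Lemma cluster_of_triangulation T : is_triangulation p T -> is_c_cluster g (rays T).
Proof.
move=> [dT cT ncT]; split.
  split=> [_ [d /dT dd ->]|_ _ [d dT' ->] [e eT ->] ne]; first exact: v_root.
  have de : d <> e by move=> de; apply: ne; rewrite de.
  by apply/(v_compat (dT _ dT') (dT _ eT) de); apply: ncT.
move=> S' [rS' cS'] sub; apply/seteqP; split=> // b Sb.
have [d dd bE] := v_surj (rS' _ Sb).
suff h : d \in T by exists d.
apply/negPn/negP => dNT; have : #|(d |: T)%SET| <= n.
  apply: (noncrossing_diagonals_card_le hp) => [e|].
    by rewrite !inE => /orP[/eqP ->|/dT].
  have nc e : e \in T -> ~ crosses p d e /\ ~ crosses p e d.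
    move=> eT; have de : d <> e by move=> de; rewrite de eT in dNT.
    have vde : v d <> v e by move=> /(v_inj dd (dT _ eT)).
    have Se : S' (v e) by apply: sub; exists e.
    split; [apply/(v_compat dd (dT _ eT) de)|apply/(v_compat (dT _ eT) dd (nesym de))];
      by apply: cS'; rewrite -?bE //; rewrite ?bE //; apply: nesym.
  move=> e f; rewrite !inE => /orP[/eqP ->|eT] /orP[/eqP ->|fT].
  - by case=> h; case: h.
  - by have [] := nc _ fT.
  - by have [] := nc _ eT.
  - exact: ncT.
by rewrite cardsU1 dNT cT ltnn.
Qed.

Lemma triangulation_of_cluster S : is_c_cluster g S ->
  exists2 T, is_triangulation p T & S = rays T.
Proof.
move=> [[rS cS] maxS].
pose T := [set d : {set 'I_n.+3} | is_diagonal d && `[< S (v d) >]]%SET.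
have TP d : d \in T -> is_diagonal d /\ S (v d) by rewrite inE => /andP[h /asboolP].
have SE : S = rays T.
  apply/seteqP; split=> [b Sb|_ [d /TP[_ Sd] ->] //].
  have [d dd bE] := v_surj (rS _ Sb).
  by exists d => //; rewrite inE dd /=; apply/asboolP; rewrite -bE.
have ncT d e : d \in T -> e \in T -> ~ crosses p d e.
  move=> /TP[dd Sd] /TP[de Se] cr; have ne : d <> e by case: cr.
  move: cr; apply/(v_compat dd de ne); apply: cS => // /(v_inj dd de); exact: ne.
exists T => //; split=> // [d /TP[]//|].
apply: (maximal_noncrossing_diagonals_card hp) => // [d /TP[]//|d dd nc].
rewrite inE dd /=; apply/asboolP.
(* Maximality of the cluster puts into [S] the root of any diagonal that crosses none of [T]; so [T]
   is maximal and has n elements. *)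
rewrite -(maxS (S `|` [set v d])); [by right| |by left].
split=> [b [/rS//|->]|b1 b2]; first exact: v_root.
have compat e : e \in T -> v e <> v d -> c_compatible g (v d) (v e) /\ c_compatible g (v e) (v d).
  move=> eT ne; have [de Se] := TP _ eT.
  have ne' : d <> e by move=> h; apply: ne; rewrite h.
  have cr := nc _ eT; split; first by apply/(v_compat dd de ne').
  apply/(v_compat de dd (nesym ne')) => -[_ [x [h1 h2]]].
  by apply: cr; split=> //; exists x.
move=> [S1|->] [S2|->] ne //.
- exact: cS.
- have : rays T b1 by rewrite -SE.
  by move=> [e eT h]; rewrite h in ne *; have [] := compat _ eT ne.
- have : rays T b2 by rewrite -SE.
  by move=> [e eT h]; rewrite h in ne *; have [] := compat _ eT (nesym ne).
Qed.
End ClustersOfTriangulations.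

Theorem proposition5p10 (R : realType) (n : nat) (hn : (0 < n)%N)
    (p : 'I_n.+3 -> (R * R)%type) (hp : convex_polygon p)
    (c : n.-1.-tuple bool)
    (delta : 'I_n -> {set 'I_n.+3}) (hdelta : is_path_triangulation p c delta)
    (g : 'S_n.+1) (hg : represents c g) :
  santos_fan p delta = c_cluster_fan g /\
  (forall P : set 'rV[R]_n.+1,
     is_santos_associahedron p delta P -> normal_fan P = c_cluster_fan g).
Proof.
suff fanE : santos_fan p delta = c_cluster_fan g by split=> // P [_ ->].
have [triT [t pathT] turns] := hdelta; have [w [pw signs gw]] := hg.
have [X [Y [O [I frame]]]] := zigzag_exists hp triT pathT hn.
(* The link between the two sides: the signs read off from g are those that prescribe the turns of
   the dual path. *)
have epsE (i j : 'I_n) : j = i.+1 :> nat -> coxeter_sign g j = nth false c i.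
  move=> ij; rewrite gw (coxeter_sign_word pw ij); have := signs i j ij.
  by case: ifP => _ // h; apply: leq_gtF; apply: ltnW.
pose v := diagonal_vector p delta.
have surj := diagonal_of_root_surj hp triT pathT frame.
have vE := diagonal_vector_of_root hp triT pathT frame.
have crossE := crosses_diagonal_of_root hp triT pathT turns epsE frame.
have isdiag := is_diagonal_of_root hp triT pathT frame.
have v_root d : is_diagonal d -> almost_positive_root (v d).
  by move=> /surj[a [b [vab ->]]]; rewrite /v vE //; apply/almost_positive_rootP; exists a, b.
have v_inj d e : is_diagonal d -> is_diagonal e -> v d = v e -> d = e.
  move=> /surj[a [b [vab ->]]] /surj[k [l [vkl ->]]]; rewrite /v !vE //.
  by case/(root_inj (almost_positive_neq vab)) => -> ->.
have v_surj b : almost_positive_root b -> exists2 d, is_diagonal d & b = v d.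
  move=> /almost_positive_rootP[k [l [vkl ->]]].
  by exists (diagonal_of_root X Y O I k l); [exact: isdiag|rewrite /v vE].
have v_compat d e : is_diagonal d -> is_diagonal e -> d <> e ->
    (c_compatible g (v d) (v e) <-> ~ crosses p d e).
  move=> /surj[a [b [vab ->]]] /surj[k [l [vkl ->]]] ne; rewrite /v !vE // crossE // gw.
  rewrite c_compatibleE //; first by split=> [->//|/negP]; rewrite negbK.
  by apply/eqP => -[ea eb]; apply: ne; rewrite ea eb.
rewrite /santos_fan /c_cluster_fan; congr fan_of_maximal_cones.
apply/seteqP; split=> [C [T [triT' ->]]|_ [S clS ->]].
  exists [set b | exists2 d, d \in T & b = v d]%classic => //.
  exact: (cluster_of_triangulation hp v_root v_inj v_surj v_compat triT').
have [T triT' ->] := triangulation_of_cluster hp v_root v_inj v_surj v_compat clS.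
by exists T.
Qed.
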